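(* Let $\mathbb{F}$ be an infinite field and let $\Delta$ be a $(d-1)$-dimensional normal pseudomanifold with boundary, where $d\ge3$, with vertex set $V(\Delta)=[n]$. Then \[ \beta^S_{i,i+1}\big(\mathbb{F}[\Delta,\partial\Delta]\big)\le g_1(\Delta,\partial\Delta)\binom{n-d-1}{i}\quad\text{for all }i\ge0. \]
   Context: A $(d-1)$-dimensional simplicial complex $\Delta$ is a normal pseudomanifold if it is pure, every $(d-2)$-face (ridge) lies in at most two facets, and the link $\{H:H\cup G\in\Delta,H\cap G=\emptyset\}$ of every nonempty face $G$ of dimension $\le d-3$ is connected; it is a normal pseudomanifold with boundary if some ridge lies in exactly one facet, and $\partial\Delta$ is then the pure $(d-2)$-dimensional complex whose facets are those ridges. The relative complex $(\Delta,\partial\Delta)$ consists of the faces of $\Delta$ not in $\partial\Delta$; $f_i(\Delta,\partial\Delta)$ counts its faces of cardinality $i+1$, and $g_1(\Delta,\partial\Delta)=h_1-h_0=f_0(\Delta,\partial\Delta)-(d+1)f_{-1}(\Delta,\partial\Delta)=f_0(\Delta,\partial\Delta)$ is its number of vertices (interior vertices of $\Delta$). $S=\mathbb{F}[x_1,\dots,x_n]$; for a complex $K$ on $[n]$, $I_K$ is generated by the monomials $x_{i_1}\cdots x_{i_m}$ with $\{i_1,\dots,i_m\}\notin K$, and $\mathbb{F}[\Delta,\partial\Delta]=I_{\partial\Delta}/I_\Delta$. $\beta^S_{i,j}(M)=\dim_{\mathbb{F}}\mathrm{Tor}^S_i(M,\mathbb{F})_j$.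
   Formalization: Δ is additionally assumed connected (link condition also for the empty face); the claim fails otherwise, e.g. for the disjoint union of a solid (d−1)-simplex and the boundary of a d-simplex, with i = 2d. *)

(* Defs.v *)
From HB Require Import structures.
From mathcomp Require Import all_boot all_order all_algebra.
From mathcomp Require Import mpoly.

Set Implicit Arguments.
Unset Strict Implicit.
Unset Printing Implicit Defensive.

Import GRing.Theory.

Local Open Scope ring_scope.

Definition infinite_type (T : eqType) : Prop :=
  forall s : seq T, exists x : T, x \notin s.

Section Complexes.
Variable n : nat.
Implicit Types (K : {set {set 'I_n}}) (A B G H R : {set 'I_n}).

(* The empty set is always a face; V(K) may be smaller than 'I_n. *)
Definition simplicial_complex K : Prop :=
  set0 \in K /\ (forall A B, A \in K -> B \subset A -> B \in K).

Definition full_vertex_set K : Prop := forall v : 'I_n, [set v] \in K.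

Definition facets K : {set {set 'I_n}} :=
  [set A | maxset (fun B => B \in K) A].

(* Faces are measured by cardinality = dimension + 1. *)
Definition pure_of_card (d : nat) K : Prop :=
  forall A, A \in facets K -> #|A| = d.

Definition link K G : {set {set 'I_n}} :=
  [set H | (H :|: G \in K) && [disjoint H & G]].

Definition connected_complex K : Prop :=
  forall u v : 'I_n, [set u] \in K -> [set v] \in K ->
    connect (fun a b => [set a; b] \in K) u v.

Definition facets_above K R : {set {set 'I_n}} :=
  [set A in facets K | R \subset A].

(* A normal pseudomanifold is connected by convention: without this, links of
   nonempty faces would allow the disjoint union of a ball and a sphere. *)
Record normal_pseudomanifold (d : nat) K : Prop := NormalPseudomanifold {
  npm_complex : simplicial_complex K;
  npm_pure : pure_of_card d K;
  npm_ridge : forall R, R \in K -> #|R| = d.-1 -> (#|facets_above K R| <= 2)%N;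
  npm_connected : connected_complex K;
  npm_link : forall G, G \in K -> G != set0 -> (#|G| + 2 <= d)%N ->
    connected_complex (link K G)
}.

Definition boundary_ridges (d : nat) K : {set {set 'I_n}} :=
  [set R in K | (#|R| == d.-1) && (#|facets_above K R| == 1)%N].

Definition boundary (d : nat) K : {set {set 'I_n}} :=
  [set A : {set 'I_n} | [exists R in boundary_ridges d K, A \subset R]].

Definition normal_pseudomanifold_with_boundary (d : nat) K : Prop :=
  normal_pseudomanifold d K /\ boundary_ridges d K != set0.

(* The relative complex (K, boundary of K), as its set of faces. *)
Definition relative_faces (d : nat) K : {set {set 'I_n}} :=
  K :\: boundary d K.

(* [face_count Q k] is f_(k-1). *)
Definition face_count (Q : {set {set 'I_n}}) (k : nat) : nat :=
  #|[set A in Q | #|A| == k]|.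

Definition h_number (d : nat) (Q : {set {set 'I_n}}) (j : nat) : int :=
  \sum_(k < j.+1)
    (-1) ^+ (j - k) * ('C(d - k, j - k))%:Z * (face_count Q k)%:Z.

Definition g1_number (d : nat) (Q : {set {set 'I_n}}) : int :=
  h_number d Q 1 - h_number d Q 0.

End Complexes.

Section Tor.
Variables (F : fieldType) (n : nat).
Local Notation S := {mpoly F[n]}.

Definition ideal_generated (gens : S -> Prop) (p : S) : Prop :=
  exists2 s : seq (S * S),
    (forall c, c \in s -> gens c.2) & p = \sum_(c <- s) c.1 * c.2.

Definition stanley_reisner_ideal (K : {set {set 'I_n}}) : S -> Prop :=
  ideal_generated (fun p =>
    exists2 A : {set 'I_n}, A \notin K & p = \prod_(i in A) 'X_i).

(* Graded resolutions, by finitely generated graded free S-modules, of the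
   graded module I / J, for homogeneous ideals J <= I of S:
     ... -> P_2 -> P_1 -> P_0 -> I / J -> 0.
   P_i is the module of row vectors of length [res_rank i] whose k-th basis
   vector has degree [res_deg i k]; P_(i+1) -> P_i is right multiplication by
   [res_diff i]; P_0 -> I / J sends the k-th basis vector to the class of
   [res_aug k]. Elements of I / J are handled through representatives in I,
   equality in I / J being congruence modulo J. *)
Record graded_free_resolution (I J : S -> Prop) := GradedFreeResolution {
  res_rank : nat -> nat;
  res_deg : forall i, 'I_(res_rank i) -> nat;
  res_aug : 'I_(res_rank 0) -> S;
  res_diff : forall i, 'M[S]_(res_rank i.+1, res_rank i);
  res_aug_mem : forall k, I (res_aug k);
  res_aug_homog : forall k, res_aug k \is (res_deg k).-homog;
  res_diff_homog : forall i k l m, m \in msupp (res_diff i k l) ->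
    (mdeg m + res_deg l = res_deg k)%N;
  res_aug_onto : forall p, I p ->
    exists u : 'rV[S]_(res_rank 0), J (p - \sum_k u 0 k * res_aug k);
  res_exact0 : forall u : 'rV[S]_(res_rank 0),
    J (\sum_k u 0 k * res_aug k) <-> exists w, u = w *m res_diff 0;
  res_exactS : forall i (u : 'rV[S]_(res_rank i.+1)),
    u *m res_diff i = 0 <-> exists w, u = w *m res_diff i.+1
}.

Variables (I J : S -> Prop) (P : graded_free_resolution I J).

(* F = S / (x_1, ..., x_n), so tensoring P with F over S replaces the entries
   of the differentials by their constant coefficients. *)
Definition tor_diff (i : nat) : 'M[F]_(res_rank P i.+1, res_rank P i) :=
  map_mx (mcoeff 0%MM) (res_diff P i).

(* Row space: the degree j component of the i-th term of P tensor F. *)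
Definition tor_component (i j : nat) : 'M[F]_(res_rank P i) :=
  diag_mx (\row_k (res_deg (g := P) k == j)%:R).

Definition tor_cycles (i j : nat) : 'M[F]_(res_rank P i) :=
  match i return 'M[F]_(res_rank P i) with
  | 0 => tor_component 0 j
  | i'.+1 => (tor_component i'.+1 j :&: kermx (tor_diff i'))%MS
  end.

Definition tor_boundaries (i j : nat) : 'M[F]_(res_rank P i.+1, res_rank P i) :=
  tor_component i.+1 j *m tor_diff i.

(* dim_F Tor_i(I / J, F)_j, i.e. the dimension of the degree j part of the
   i-th homology of P tensor F; it does not depend on the resolution P. *)
Definition betti (i j : nat) : nat :=
  (\rank (tor_cycles i j) - \rank (tor_boundaries i j))%N.

End Tor.

(* Main.v *)
(* Write M for the relative face module and l_1, ..., l_n for a basis of the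
   linear forms.  Tensoring a resolution P of M with S / (l_1, ..., l_k) and
   letting k grow from 0 to n, the long exact sequence of multiplication by
   l_(k+1) bounds the dimension of the linear strand at (k + 1, i + 1) by the sum
   of those at (k, i + 1) and (k, i).  If l_1, ..., l_(d+1) act injectively in
   the sense that sum_s l_s m_s = 0 with m_s in M_1 forces all m_s = 0, then the
   strand vanishes for i > 0 and k <= d + 1, and Pascal's rule over the remaining
   n - d - 1 forms gives the bound.

   With l_s = sum_v a_(v,s) x_v, the injectivity says that the graph of Delta,
   placed at the points a_v in projective d-space, has no nonzero infinitesimal
   motion fixing the boundary vertices.  Coning the boundary of Delta turns Delta
   into a minimal cycle modulo 2 of dimension d - 1 >= 2, and a theorem of
   Fogelsanger says that the graph of such a cycle is generically rigid: contract
   an edge uv, decompose the resulting cycle into minimal ones, which are rigid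
   by induction, lift these back by vertex splitting, and glue. *)

Require Import Defs.
From HB Require Import structures.
From mathcomp Require Import all_boot all_order all_algebra perm.
From mathcomp Require Import mpoly.

Set Implicit Arguments.
Unset Strict Implicit.
Unset Printing Implicit Defensive.

Import GRing.Theory.

Local Open Scope ring_scope.

(** * Infinitesimal rigidity of placements in general position *)

(** The coefficient of [x_u x_v] in [sum_s l_s m_s] gives the rigidity equation of the edge [uv];
    that of [x_v^2] gives an equation at the vertex [v], of which the edge equation with [u = v]
    would be the double. Keeping it separate makes the argument independent of the characteristic. A
    motion that fixes the boundary extends by zero velocity to the apex of the cone, wherever the
    apex is placed. The induction runs over cycles because contracting an edge of a pseudomanifold
    need not give a pseudomanifold, whereas it always maps cycles modulo 2 to cycles. Lifting a
    piece back may require facets absent from the original cycle; this is harmless, since rigidity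
    depends only on the graph and their edges are all present. Pieces can be glued because a shared
    facet has [d] vertices, enough to determine an alternating matrix in general position. *)

Lemma nonroot_exists (F : fieldType) (p : {poly F}) :
  infinite_type F -> p != 0 -> exists t, p.[t] != 0.
Proof.
move=> F_infinite p0.
have [s [us szs]] : exists s : seq F, uniq s /\ size s = size p.
  elim: (size p) => [|m [s [us <-]]]; first by exists [::].
  by have [x xs] := F_infinite s; exists (x :: s); rewrite /= xs us.
have : ~~ all (root p) s.
  by apply/negP => /(max_poly_roots p0)/(_ us); rewrite szs ltnn.
by case/allPn => t _ pt; exists t.
Qed.

Section DotProduct.
Variables (F : fieldType) (d : nat).
Local Notation vec := 'rV[F]_d.+1.
Implicit Types x y z : vec.

Definition dot (x y : vec) : F := \sum_j x 0 j * y 0 j.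

Lemma dotC x y : dot x y = dot y x.
Proof. by apply: eq_bigr => j _; rewrite mulrC. Qed.

Lemma dotDl x y z : dot (x + y) z = dot x z + dot y z.
Proof. by rewrite /dot -big_split; apply: eq_bigr => j _; rewrite mxE mulrDl. Qed.

Lemma dotZl t x z : dot (t *: x) z = t * dot x z.
Proof. by rewrite /dot mulr_sumr; apply: eq_bigr => j _; rewrite mxE mulrA. Qed.

Lemma dotDr x y z : dot z (x + y) = dot z x + dot z y.
Proof. by rewrite !(dotC z) dotDl. Qed.

Lemma dotZr t x z : dot z (t *: x) = t * dot z x.
Proof. by rewrite !(dotC z) dotZl. Qed.

Lemma dot0r x : dot x 0 = 0.
Proof. by rewrite -(scale0r 0) dotZr mul0r. Qed.

Lemma dotNr x y : dot x (- y) = - dot x y.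
Proof. by rewrite -scaleN1r dotZr mulN1r. Qed.

End DotProduct.

(** * Linear systems depending polynomially on a parameter *)

Section TrivialKernel.
Variables (F : fieldType) (T : finType) (d : nat).
Local Notation vec := 'rV[F]_d.+1.
Implicit Types c : T -> vec.

Definition poly_linear (L : F -> (T -> vec) -> F) :=
  exists p : T -> 'I_d.+1 -> {poly F},
    forall t c, L t c = \sum_v \sum_j (p v j).[t] * c v 0 j.

Lemma poly_linear0 : poly_linear (fun _ _ => 0).
Proof.
exists (fun _ _ => 0) => t c; rewrite big1 // => v _; rewrite big1 // => j _.
by rewrite horner0 mul0r.
Qed.

Lemma poly_linearD L1 L2 : poly_linear L1 -> poly_linear L2 ->
  poly_linear (fun t c => L1 t c + L2 t c).
Proof.
case=> p1 E1 [p2 E2]; exists (fun v j => p1 v j + p2 v j) => t c.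
rewrite E1 E2 -big_split; apply: eq_bigr => v _.
by rewrite -big_split; apply: eq_bigr => j _; rewrite hornerD mulrDl.
Qed.

Lemma poly_linear_if (P : bool) L : poly_linear L ->
  poly_linear (fun t c => if P then L t c else 0).
Proof. by case: P => // _; apply: poly_linear0. Qed.

Lemma poly_linear_dot (q : 'I_d.+1 -> {poly F}) (v : T) :
  poly_linear (fun t c => \sum_j (q j).[t] * c v 0 j).
Proof.
exists (fun w j => if w == v then q j else 0) => t c.
rewrite [RHS](bigD1 v) //= [X in _ + X]big1 ?addr0.
  by apply: eq_bigr => j _; rewrite eqxx.
by move=> w /negPf->; rewrite big1 // => j _; rewrite horner0 mul0r.
Qed.

Lemma poly_linear_line (x y : vec) (v : T) :
  poly_linear (fun t c => dot (x + t *: y) (c v)).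
Proof.
have [p Ep] := poly_linear_dot (fun j => (x 0 j)%:P + y 0 j *: 'X) v.
exists p => t c; rewrite -Ep; apply: eq_bigr => j _.
by rewrite !mxE hornerD hornerC hornerZ hornerX [y 0 j * _]mulrC.
Qed.

Lemma poly_linear_coord (v : T) (j : 'I_d.+1) :
  poly_linear (fun _ c => c v 0 j).
Proof.
have [p Ep] := poly_linear_dot (fun k => (k == j)%:R) v.
exists p => t c; rewrite -Ep (bigD1 j) //= eqxx hornerC mul1r big1 ?addr0 //.
by move=> k /negPf->; rewrite horner0 mul0r.
Qed.

(** Injectivity at [t0] gives a one-sided inverse [B] of the matrix there. The polynomial
    [det (M(t) B)] equals 1 at [t0], and wherever it is nonzero the system is still injective. *)
Lemma trivial_kernel_open (I : finType) (L : I -> F -> (T -> vec) -> F) t0 :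
    (forall i, poly_linear (L i)) ->
    (forall c, (forall i, L i t0 c = 0) -> forall v, c v = 0) ->
  exists2 r : {poly F}, r.[t0] != 0 & forall t, r.[t] != 0 ->
    forall c, (forall i, L i t c = 0) -> forall v, c v = 0.
Proof.
move=> /fin_all_exists[p Ep] ker0.
pose K : finType := (T * 'I_d.+1)%type.
pose M : 'M[{poly F}]_(#|K|, #|I|) :=
  \matrix_(x, y) p (enum_val y) (enum_val x).1 (enum_val x).2.
pose ev t : 'M[F]_(#|K|, #|I|) := map_mx (horner_eval t) M.
pose vc (z : 'rV[F]_#|K|) : T -> vec := fun v => \row_j z 0 (enum_rank (v, j)).
have evE t (z : 'rV_#|K|) i : (z *m ev t) 0 (enum_rank i) = L i t (vc z).
  rewrite mxE Ep pair_bigA /= (reindex (@enum_rank K)) /=; last first.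
    by exists enum_val => x _; rewrite ?enum_rankK ?enum_valK.
  apply: eq_bigr => -[v j] _; rewrite !mxE !enum_rankK /= mulrC.
  by rewrite /horner_eval.
have /row_freeP[B MB1] : row_free (ev t0).
  apply: inj_row_free => z z0; have vc0 : forall v, vc z v = 0.
    by apply: ker0 => i; rewrite -evE z0 mxE.
  apply/rowP => x; have := vc0 (enum_val x).1; move/rowP/(_ (enum_val x).2).
  by rewrite !mxE -surjective_pairing enum_valK.
pose r := \det (M *m map_mx polyC B).
have rE t : r.[t] = \det (ev t *m B).
  rewrite -[LHS]/(horner_eval t r) -det_map_mx map_mxM; congr (\det (_ *m _)).
  by rewrite -map_mx_comp map_mx_id // => x; rewrite /= /horner_eval hornerC.
exists r; first by rewrite rE MB1 det1 oner_neq0.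
move=> t rt c Lc0 v.
pose z : 'rV[F]_#|K| := \row_x c (enum_val x).1 0 (enum_val x).2.
have vcz w : vc z w = c w by apply/rowP => j; rewrite !mxE enum_rankK.
have zev : z *m ev t = 0.
  apply/rowP => y; rewrite -(enum_valK y) evE mxE -(Lc0 (enum_val y)) !Ep.
  by apply: eq_bigr => w _; apply: eq_bigr => j _; rewrite vcz.
have U : ev t *m B \in unitmx by rewrite unitmxE unitfE -rE.
have z0 : z = 0.
  by rewrite -[z]mulmx1 -(mulmxV U) !mulmxA zev !mul0mx.
by rewrite -vcz z0; apply/rowP => j; rewrite !mxE.
Qed.
End TrivialKernel.

(** * Rigid and pinned-rigid placements *)

Section Rigidity.
Variables (F : fieldType) (T : finType) (d : nat).
Local Notation vec := 'rV[F]_d.+1.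
Local Notation placement := {ffun T -> vec}.
Implicit Types (a b : placement) (c : T -> vec) (C : {set {set T}}) (A : 'M[F]_d.+1).

(** Vanishing of the quadratic form rather than skew symmetry, so that the notion is right in
    characteristic 2 as well. *)
Definition alternating A := forall x, dot x (x *m A) = 0.

Lemma alternating_skew A x y : alternating A -> dot x (y *m A) = - dot y (x *m A).
Proof.
move=> altA; apply/eqP; rewrite -addr_eq0; apply/eqP.
have := altA (x + y).
by rewrite mulmxDl dotDl !dotDr !altA add0r addr0.
Qed.

(** Reflexive on vertices: [adj C x x] holds exactly when [x] lies in [cover C], so [motion] imposes
    the diagonal equations too. *)
Definition adj C x y := [exists f in C, (x \in f) && (y \in f)].

Lemma adjC C x y : adj C x y = adj C y x.
Proof. by apply: eq_existsb => f; rewrite [(x \in f) && _]andbC. Qed.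

(* The points [a v] are given by homogeneous coordinates; the trivial motions are
   those of the form [a v *m A] with [A] alternating. *)
Definition motion a C c := forall x y, adj C x y ->
  (x = y -> dot (a x) (c x) = 0) /\ dot (a x) (c y) + dot (a y) (c x) = 0.

Definition rigid a C := forall c, motion a C c ->
  exists2 A, alternating A & {in cover C, forall v, c v = a v *m A}.

(** Unlike [rigid], this is injectivity of a linear system, to which [trivial_kernel_open] applies;
    fixing a facet removes the trivial motions. *)
Definition pinned_rigid a C (s : {set T}) := forall c, motion a C c ->
  {in s, forall v, c v = 0} -> {in cover C, forall v, c v = 0}.

Definition general_position a := forall s : {set T}, #|s| = d.+1 ->
  forall x, {in s, forall v, dot (a v) x = 0} -> x = 0.

(* This replaces Zariski openness: over an infinite field, finitely many nonempty
   sets of this kind have a common point, found on the line joining two points. *)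
Definition line_open (U : placement -> Prop) := forall a b, U a ->
  exists2 p : {poly F}, p != 0 & forall t, p.[t] != 0 -> U (a + t *: b).

Lemma line_openI U W : line_open U -> line_open W -> line_open (fun a => U a /\ W a).
Proof.
move=> oU oW a b [Ua Wa]; have [p p0 Up] := oU a b Ua; have [q q0 Wq] := oW a b Wa.
exists (p * q); first by rewrite mulf_neq0.
move=> t; rewrite hornerM mulf_eq0 negb_or => /andP[pt qt].
by split; [apply: Up | apply: Wq].
Qed.

Lemma line_open_meet U W : infinite_type F -> line_open U -> line_open W ->
  (exists a, U a) -> (exists a, W a) -> exists a, U a /\ W a.
Proof.
move=> Finf oU oW [a0 U0] [a1 W1].
have [p p0 Up] := oU a0 (a1 - a0) U0; have [q q0 Wq] := oW a1 (a0 - a1) W1.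
(* [p] and [q] belong to the same line run in opposite directions; the substitution [1 - X] aligns
   the parameters. *)
have : p * (q \Po (1 - 'X)) != 0.
  rewrite mulf_neq0 // comp_poly2_eq0 //.
  by rewrite -opprB size_polyN size_XsubC.
case/(nonroot_exists Finf)=> t; rewrite hornerM mulf_eq0 negb_or => /andP[pt].
rewrite horner_comp !hornerE => qt.
exists (a0 + t *: (a1 - a0)); split; first exact: Up.
have -> : a0 + t *: (a1 - a0) = a1 + (1 - t) *: (a0 - a1); last exact: Wq.
by rewrite scalerBl scale1r -scalerN opprB [RHS]addrA [a1 + (a0 - a1)]addrC subrK.
Qed.

Lemma line_open_all (I : eqType) (s : seq I) (U : I -> placement -> Prop) :
    infinite_type F -> {in s, forall i, line_open (U i) /\ exists a, U i a} ->
  line_open (fun a => {in s, forall i, U i a}) /\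
    exists a, {in s, forall i, U i a}.
Proof.
move=> Finf; elim: s => [|i s IHs] Us.
  by split=> [a b _|]; [exists 1; rewrite ?oner_neq0 | exists 0].
have [|oUs neUs] := IHs; first by move=> j js; apply: Us; rewrite inE js orbT.
have [oUi neUi] : line_open (U i) /\ exists a, U i a by apply: Us; rewrite mem_head.
have memP a : {in i :: s, forall j, U j a} <-> U i a /\ {in s, forall j, U j a}.
  split=> [H | [Hi Hs] j]; last by rewrite inE => /predU1P[->|/Hs].
  by split=> [|j js]; apply: H; rewrite inE ?eqxx ?js ?orbT.
split; last by have [a /memP] := line_open_meet Finf oUi oUs neUi neUs; exists a.
move=> a b /memP /(line_openI oUi oUs b)[p p0 Up]; exists p => // t pt.
exact/memP/Up.
Qed.

Lemma line_open_spanning (s : {set T}) :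
  line_open (fun a => forall x, {in s, forall v, dot (a v) x = 0} -> x = 0).
Proof.
move=> a b Ua.
pose L (v : T) (t : F) (c : unit -> vec) :=
  if v \in s then dot (a v + t *: b v) (c tt) else 0.
have [||p p0 Up] := @trivial_kernel_open _ _ _ _ L 0.
- by move=> v; apply: poly_linear_if; apply: poly_linear_line.
- move=> c Lc []; apply: Ua => v vs; have := Lc v.
  by rewrite /L vs scale0r addr0.
exists p; first by apply: contraNneq p0 => ->; rewrite horner0.
move=> t pt x Hx; apply: (Up t pt (fun=> x) _ tt) => v; rewrite /L.
by case: ifP => // /Hx; rewrite !ffunE.
Qed.

Lemma spanning_exists (s : {set T}) : #|s| = d.+1 ->
  exists a, forall x, {in s, forall v, dot (a v) x = 0} -> x = 0.
Proof.
move=> cs.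
exists [ffun v => delta_mx 0 (inord (index v (enum s)))] => x Hx.
apply/rowP => j; rewrite mxE.
have [v0 v0s] : exists v, v \in s by apply/card_gt0P; rewrite cs.
have js : (j < size (enum s))%N by rewrite -cardE cs.
have := Hx (nth v0 (enum s) j).
rewrite -mem_enum mem_nth // => /(_ isT).
rewrite ffunE index_uniq ?enum_uniq // inord_val /dot (bigD1 j) //= mxE !eqxx mul1r.
by rewrite big1 ?addr0 // => k /negPf kj; rewrite mxE kj andbF mul0r.
Qed.

Lemma line_open_general_position : infinite_type F ->
  line_open general_position /\ exists a, general_position a.
Proof.
move=> Finf.
pose U (s : {set T}) a := forall x, {in s, forall v, dot (a v) x = 0} -> x = 0.
have [|o e] := @line_open_all _ (enum [set s : {set T} | #|s| == d.+1]) U Finf.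
  move=> s; rewrite mem_enum inE => /eqP cs; split; last exact: spanning_exists.
  exact: line_open_spanning.
have memP a : {in enum [set s : {set T} | #|s| == d.+1], forall s, U s a} <->
    general_position a.
  split=> H s; last by rewrite mem_enum inE => /eqP; apply: H.
  by move=> cs; apply: H; rewrite mem_enum inE cs.
split; last by have [a /memP] := e; exists a.
move=> a b /memP /(o a b)[p p0 Up]; exists p => // t pt.
exact/memP/Up.
Qed.

Lemma line_open_pinned_rigid C s : line_open (fun a => pinned_rigid a C s).
Proof.
move=> a b Ua.
(* The motion equations do not constrain velocities off [cover C]; these are set to zero to make the
   kernel trivial. *)
pose L (i : (T * T) + (T + T * 'I_d.+1)) (t : F) (c : T -> vec) :=
  match i with
  | inl (x, y) => if adj C x y then
      dot (a x + t *: b x) (c y) + dot (a y + t *: b y) (c x) else 0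
  | inr (inl x) => if adj C x x then dot (a x + t *: b x) (c x) else 0
  | inr (inr (v, j)) => if (v \in s) || (v \notin cover C) then c v 0 j else 0
  end.
have LP t c : (forall i, L i t c = 0) <->
   [/\ motion (a + t *: b) C c, {in s, forall v, c v = 0} &
       forall v, v \notin cover C -> c v = 0].
  split=> [L0 | [mo s0 C0] [[x y]|[x|[v j]]] /=].
  - split.
    + move=> x y xy; split=> [exy | ].
        by have := L0 (inr (inl x)); rewrite /= !ffunE {1}exy adjC xy.
      by have := L0 (inl (x, y)); rewrite /= xy !ffunE.
    + by move=> v vs; apply/rowP=> j; have := L0 (inr (inr (v, j))); rewrite /= vs mxE.
    + move=> v vs; apply/rowP=> j; have := L0 (inr (inr (v, j))).
      by rewrite /= vs orbT mxE.
  - by case: ifP => // /mo[_]; rewrite !ffunE.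
  - by case: ifP => // /mo[/(_ erefl)]; rewrite !ffunE.
  - by case: ifP => // /orP[/s0|/C0] ->; rewrite mxE.
have [||p p0 Up] := @trivial_kernel_open _ _ _ _ L 0.
- case=> [[x y]|[x|[v j]]] /=; apply: poly_linear_if.
  + by apply: poly_linearD; apply: poly_linear_line.
  + exact: poly_linear_line.
  + exact: poly_linear_coord.
- move=> c /LP[mo s0 C0] v; have [vC|/C0 //] := boolP (v \in cover C).
  by apply: Ua vC => //; rewrite scale0r addr0 in mo.
exists p; first by apply: contraNneq p0 => ->; rewrite horner0.
move=> t pt c mo s0 v vC.
have := Up t pt (fun v => if v \in cover C then c v else 0) _ v.
rewrite vC; apply; apply/LP; split.
- move=> x y xy; have := mo x y xy.
  have [f /andP[fC /andP[xf yf]]] := existsP xy.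
  have -> : x \in cover C by apply/bigcupP; exists f.
  by have -> : y \in cover C by apply/bigcupP; exists f.
- by move=> w ws; case: ifP => // _; apply: s0.
- by move=> w /negPf->.
Qed.

Lemma skew_quadratic m (N : 'I_m -> 'I_m -> F) (l : 'I_m -> F) :
    (forall i, N i i = 0) -> (forall i j, N i j + N j i = 0) ->
  \sum_i \sum_j l i * l j * N i j = 0.
Proof.
elim: m N l => [|m IHm] N l N0 NN; first by rewrite big_ord0.
rewrite big_ord_recl big_ord_recl N0 mulr0 add0r.
under [X in _ + X]eq_bigr do rewrite big_ord_recl.
rewrite big_split /= IHm ?addr0 //.
rewrite -big_split big1 // => i _ /=.
by rewrite [l (lift _ _) * _]mulrC -mulrDr NN mulr0.
Qed.

(** The points of [s] form a basis, so a linear map sends each to its velocity; the equations on all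
    pairs make its form alternating. *)
Lemma basis_interpolation a (s : {set T}) c : general_position a -> #|s| = d.+1 ->
    {in s &, forall x y, (x = y -> dot (a x) (c x) = 0) /\
                         dot (a x) (c y) + dot (a y) (c x) = 0} ->
  exists2 A, alternating A & {in s, forall v, c v = a v *m A}.
Proof.
move=> gp cs mo.
have [v0 v0s] : exists v, v \in s by apply/card_gt0P; rewrite cs.
pose e (i : 'I_d.+1) := nth v0 (enum s) i.
have es i : e i \in s by rewrite -mem_enum mem_nth // -cardE cs.
have eP v : v \in s -> exists i, v = e i.
  move=> vs; have iv : (index v (enum s) < d.+1)%N.
    by rewrite -cs cardE index_mem mem_enum.
  by exists (Ordinal iv); rewrite /e nth_index // mem_enum.
pose B : 'M[F]_d.+1 := \matrix_i a (e i).
pose Cm : 'M[F]_d.+1 := \matrix_i c (e i).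
have UB : B \in unitmx.
  rewrite -unitmx_tr -row_free_unit; apply: inj_row_free => x xB.
  apply: (gp s cs) => v /eP[i ->].
  move/rowP/(_ i): xB; rewrite !mxE => <-.
  by apply: eq_bigr => j _; rewrite !mxE mulrC.
exists (invmx B *m Cm); last first.
  move=> v /eP[i ->]; have -> : a (e i) = row i B by rewrite rowK.
  by rewrite -row_mul mulmxA mulmxV // mul1mx rowK.
move=> x; pose l := x *m invmx B.
have -> : x *m (invmx B *m Cm) = \sum_i l 0 i *: c (e i).
  by rewrite mulmxA mulmx_sum_row; apply: eq_bigr => i _; rewrite rowK.
have -> : x = \sum_i l 0 i *: a (e i).
  rewrite -[x in LHS](mulmxKV UB) mulmx_sum_row.
  by apply: eq_bigr => i _; rewrite rowK.
rewrite -[RHS](@skew_quadratic _ (fun i j => dot (a (e i)) (c (e j))) (fun i => l 0 i)).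
- have dot_suml (z : vec) (G : 'I_d.+1 -> vec) : dot (\sum_i G i) z = \sum_i dot (G i) z.
    elim/big_rec2: _ => [|i y1 y2 _ <-]; first by rewrite dotC dot0r.
    by rewrite dotDl.
  rewrite dot_suml; apply: eq_bigr => i _; rewrite dotZl dotC dot_suml big_distrr.
  by apply: eq_bigr => j _; rewrite /= dotZl dotC mulrA.
- by move=> i; have [/(_ erefl)] := mo _ _ (es i) (es i).
- by move=> i j; have [] := mo _ _ (es i) (es j).
Qed.

(** To complete the [d] points to a basis, [z] is given a velocity [y] that solves the [d + 1]
    equations it has to satisfy with [s] and with itself. *)
Lemma clique_interpolation a (s : {set T}) (z : T) c :
    general_position a -> #|s| = d -> z \notin s ->
    {in s &, forall x y, (x = y -> dot (a x) (c x) = 0) /\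
                         dot (a x) (c y) + dot (a y) (c x) = 0} ->
  exists2 A, alternating A & {in s, forall v, c v = a v *m A}.
Proof.
move=> gp cs zs mo.
have cS : #|z |: s| = d.+1 by rewrite cardsU1 zs cs.
pose e (i : 'I_d.+1) := nth z (enum (z |: s)) i.
have eP v : v \in z |: s -> exists i, v = e i.
  move=> vs; have iv : (index v (enum (z |: s)) < d.+1)%N.
    by rewrite -cS cardE index_mem mem_enum.
  by exists (Ordinal iv); rewrite /e nth_index // mem_enum.
pose B : 'M[F]_d.+1 := \matrix_i a (e i).
have UB : B^T \in unitmx.
  rewrite -row_free_unit; apply: inj_row_free => x xB.
  apply: (gp _ cS) => v /eP[i ->].
  move/rowP/(_ i): xB; rewrite !mxE => <-.
  by apply: eq_bigr => j _; rewrite !mxE mulrC.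
pose target : vec := \row_i (if e i == z then 0 else - dot (a z) (c (e i))).
pose y := target *m invmx B^T.
have yP v : v \in z |: s -> dot (a v) y = if v == z then 0 else - dot (a z) (c v).
  case/eP=> i ->; have := mulmxKV UB target; rewrite -/y => /rowP/(_ i).
  rewrite !mxE => <-; apply: eq_bigr => j _; rewrite !mxE.
  by rewrite mulrC.
have [x w xs ws|A altA EA] :=
  @basis_interpolation a (z |: s) (fun v => if v == z then y else c v) gp cS.
  have [-> | xz] := eqVneq x z; have [-> | wz] := eqVneq w z.
  - by rewrite yP ?setU11 // eqxx addr0.
  - split=> [zw|]; first by rewrite zw eqxx in wz.
    by rewrite yP // (negPf wz) subrr.
  - split=> [zw|]; first by rewrite zw eqxx in xz.
    by rewrite yP // (negPf xz) addNr.
  - by apply: mo; [move: xs | move: ws]; rewrite !inE ?(negPf xz) ?(negPf wz).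
exists A => // v vs; rewrite -EA ?inE ?vs ?orbT //.
by case: eqP => // vz; rewrite -vz vs in zs.
Qed.

(** Skewness makes [a z *m A] orthogonal to the points of [s], and alternation to [a z], so it
    vanishes; then [A] kills a basis. *)
Lemma alternating_eq0 a (s : {set T}) (z : T) A :
    general_position a -> #|s| = d -> z \notin s -> alternating A ->
    {in s, forall v, a v *m A = 0} -> A = 0.
Proof.
move=> gp cs zs altA sA.
have cS : #|z |: s| = d.+1 by rewrite cardsU1 zs cs.
have zA : a z *m A = 0.
  apply: (gp _ cS) => v; rewrite !inE => /predU1P[->|vs]; first exact: altA.
  by rewrite alternating_skew // sA // dot0r oppr0.
apply/trmx_inj/row_matrixP => j; rewrite trmx0 row0.
apply: (gp _ cS) => v vs.
have : a v *m A = 0 by move: vs; rewrite !inE => /predU1P[->|/sA].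
move/rowP/(_ j); rewrite !mxE => <-.
by apply: eq_bigr => k _; rewrite !mxE.
Qed.

Lemma rigid_of_pinned a C (s : {set T}) (z : T) :
    general_position a -> s \in C -> #|s| = d -> z \notin s ->
  pinned_rigid a C s -> rigid a C.
Proof.
move=> gp sC cs zs pin c mo.
have [x y xs ys|A altA EA] := @clique_interpolation a s z c gp cs zs.
  by apply: mo; apply/existsP; exists s; rewrite sC xs ys.
exists A => // v vC; apply/eqP; rewrite -subr_eq0; apply/eqP.
apply: (pin (fun v => c v - a v *m A)) vC; last by move=> w ws; rewrite EA ?subrr.
move=> x y xy; have [dg sk] := mo x y xy; split=> [exy|].
  by rewrite dotDr dotNr altA dg ?subr0.
rewrite !dotDr !dotNr [dot (a y) (a x *m A)]alternating_skew // opprK.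
by rewrite addrACA sk addNr addr0.
Qed.

Lemma pinned_of_rigid a C (s : {set T}) (z : T) :
    general_position a -> s \in C -> #|s| = d -> z \notin s ->
  rigid a C -> pinned_rigid a C s.
Proof.
move=> gp sC cs zs rig c /rig[A altA EA] s0 v vC; rewrite EA //.
suff -> : A = 0 by rewrite mulmx0.
apply: (alternating_eq0 gp cs zs altA) => w ws; rewrite -EA ?s0 //.
by apply/bigcupP; exists s.
Qed.
End Rigidity.

(** * Vertex splitting *)

Section Splitting.
Variables (F : fieldType) (T : finType) (d : nat).
Local Notation vec := 'rV[F]_d.+1.
Local Notation placement := {ffun T -> vec}.
Implicit Types (a b : placement) (c : T -> vec) (C D : {set {set T}}).
Implicit Types (s : {set T}).

(** As [d >= 2], two vertices always lie in a common facet, one that omits a third vertex, so the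
    equations hold for all pairs. *)
Lemma simplex_rigid a s : (2 <= d)%N -> general_position a -> #|s| = d.+1 ->
  rigid a [set f : {set T} | (f \subset s) && (#|f| == d)].
Proof.
move=> d2 gp cs c mo; set D := finset _ in mo *.
have adjD : {in s &, forall x y, adj D x y}.
  move=> x y xs ys.
  have [z] : exists z, z \in s :\: [set x; y].
    apply/card_gt0P; rewrite cardsD subn_gt0 cs.
    apply: leq_ltn_trans (subset_leq_card (subsetIr _ _)) _.
    by rewrite cards2; case: (x != y); rewrite ltnS // ltnW.
  rewrite !inE negb_or -andbA => /and3P[zx zy zs].
  apply/existsP; exists (s :\ z); rewrite !inE subsetDl xs ys ![_ == z]eq_sym zx zy.
  by rewrite /= andbT; move: (cardsD1 z s); rewrite zs cs add1n => -[->].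
have [x y xs ys|A altA EA] := @basis_interpolation F T d a s c gp cs.
  by apply: mo; apply: adjD.
exists A => // v /bigcupP[f]; rewrite inE => /andP[/subsetP fs _] /fs.
exact: EA.
Qed.

(* The splitting is performed by letting [a v] tend to [a u]: the equations at
   the edge [uv] are rescaled so that they survive in the limit, where they
   force the difference of the velocities of [u] and [v] to vanish. *)
Lemma vertex_split (u v : T) (W s s' : {set T}) (D Z : {set {set T}}) a0 :
    infinite_type F -> general_position a0 -> u != v ->
    v \notin cover Z -> u \in cover Z -> cover D \subset v |: cover Z ->
    adj D u v ->
    (forall x y, x != u -> y != u -> adj Z x y -> adj D x y) ->
    (forall y, y != u -> adj Z u y -> adj D u y || adj D v y) ->
    #|W|.+1 = d -> u \notin W -> v \notin W ->
    {in W, forall w, adj D u w && adj D v w} ->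
    pinned_rigid a0 Z s' ->
    {in s', forall x, if x == u then (u \in s) || (v \in s) else x \in s} ->
  exists a, pinned_rigid a D s.
Proof.
move=> Finf gp uv vZ uZ DZ uvD ZD ZuD cW uW vW WD pin ss'.
have uD : adj D u u.
  by case/existsP: uvD => f /and3P[fD uf vf]; apply/existsP; exists f; rewrite fD uf.
(* [v] starts at the position of [u] and leaves it in the direction [a0 v]. *)
pose at_ (t : F) : placement := [ffun x => if x == v then a0 u + t *: a0 v else a0 x].
pose b : placement := [ffun x => if x == v then a0 v else 0].
pose a1 : placement := [ffun x => if x == v then a0 u else a0 x].
have at_E t x : at_ t x = a1 x + t *: b x.
  by rewrite !ffunE; case: eqP => // _; rewrite scaler0 addr0.
pose L (i : (T * T) + (T + (T * 'I_d.+1 + bool))) (t : F) (c : T -> vec) :=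
  match i with
  | inl (x, y) => if adj D x y then
      dot (a1 x + t *: b x) (c y) + dot (a1 y + t *: b y) (c x) else 0
  | inr (inl x) => if adj D x x then dot (a1 x + t *: b x) (c x) else 0
  | inr (inr (inl (x, j))) => if (x \in s) || (x \notin cover D) then c x 0 j else 0
  (* The diagonal equation at [v], minus the edge equation of [uv], plus the diagonal equation at
     [u], divided by [t]. *)
  | inr (inr (inr true)) => dot (a0 v + t *: 0) (c v) + dot (- a0 v + t *: 0) (c u)
  (* The edge equation of [uv] minus twice the diagonal equation at [u]. *)
  | inr (inr (inr false)) => dot (a0 u + t *: 0) (c v) + dot (- a0 u + t *: a0 v) (c u)
  end.
have [||r r0 Ur] := @trivial_kernel_open _ _ _ _ L 0.
- case=> [[x y]|[x|[[x j]|[]]]] /=; try apply: poly_linear_if.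
  + by apply: poly_linearD; apply: poly_linear_line.
  + exact: poly_linear_line.
  + exact: poly_linear_coord.
  + by apply: poly_linearD; apply: poly_linear_line.
  + by apply: poly_linearD; apply: poly_linear_line.
- move=> c L0.
  have edge x y : adj D x y -> dot (a1 x) (c y) + dot (a1 y) (c x) = 0.
    by move=> xy; have := L0 (inl (x, y)); rewrite /= xy !scale0r !addr0.
  have diag x : adj D x x -> dot (a1 x) (c x) = 0.
    by move=> xy; have := L0 (inr (inl x)); rewrite /= xy !scale0r !addr0.
  have pinned x : (x \in s) || (x \notin cover D) -> c x = 0.
    move=> xs; apply/rowP=> j; have := L0 (inr (inr (inl (x, j)))).
    by rewrite /= xs mxE.
  have a1v : a1 v = a0 u by rewrite ffunE eqxx.
  have a1E x : x != v -> a1 x = a0 x by rewrite ffunE => /negPf->.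
  have dotNl (x y : vec) : dot (- x) y = - dot x y by rewrite dotC dotNr dotC.
  (* At [t = 0] the two extra equations, and the differences of those at [uw] and [vw] for [w] in
     [W], make [c v - c u] orthogonal to [d + 1] points in general position. *)
  have cuv : c v = c u.
    apply/eqP; rewrite -subr_eq0; apply/eqP.
    apply: (gp (u |: (v |: W))) => [|x].
      by rewrite !cardsU1 !inE (negPf uv) (negPf uW) vW /= add1n add1n cW.
    rewrite !inE => /or3P[/eqP->|/eqP->|xW].
    + have := L0 (inr (inr (inr false))); rewrite /= !scale0r !addr0 dotNl.
      by rewrite dotDr dotNr.
    + have := L0 (inr (inr (inr true))); rewrite /= !scale0r !addr0 dotNl.
      by rewrite dotDr dotNr.
    + have [xu xv] := andP (WD x xW).
      have xnv : x != v by apply: contraNneq vW => <-.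
      have := edge u x xu; have := edge v x xv; rewrite a1v !a1E //.
      rewrite dotDr dotNr => e1 e2.
      by rewrite -[LHS](addrKA (dot (a0 u) (c x))) -!(addrC (dot (a0 u) (c x))) e1 e2 subr0.
  (* Now [u] and [v] agree in position and velocity, so an edge of [Z] at [u] satisfies its equation
     whichever of the two carries it in [D]. *)
  have c0 : {in cover Z, forall x, c x = 0}.
    apply: pin => [x y xy|x xs'].
      have [xv yv] : x != v /\ y != v.
        by case/existsP: xy => f /and3P[fZ xf yf]; split;
           apply: contraNneq vZ => <-; apply/bigcupP; exists f.
      suff H : adj D x y || ((x == u) && adj D v y || (y == u) && adj D x v).
        split=> [exy|]; last first.
          case/or3P: H => [/edge|/andP[/eqP xu /edge]|/andP[/eqP yu /edge]].
          - by rewrite !a1E.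
          - by rewrite a1v a1E // cuv xu.
          - by rewrite a1v a1E // cuv yu.
        subst y; rewrite -a1E //; apply: diag.
        case/or3P: H => // /andP[/eqP-> _] //.
      have [xu|xu] := eqVneq x u; have [yu|yu] := eqVneq y u.
      - by rewrite xu yu uD.
      - by rewrite /= orbF xu; apply: (ZuD y yu); rewrite -xu.
      - by rewrite /= adjC [adj D x v]adjC yu; apply: (ZuD x xu); rewrite -yu adjC.
      - by rewrite /= orbF; apply: ZD.
    have := ss' x xs'; case: eqP => [->|_ xs]; last by apply: pinned; rewrite xs.
    by case/orP=> [us|vs]; [|rewrite -cuv]; apply: pinned; rewrite ?us ?vs.
  move=> x; have [xD|xD] := boolP (x \in cover D); last by apply: pinned; rewrite xD orbT.
  have := subsetP DZ x xD; rewrite !inE => /predU1P[->|/c0//].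
  by rewrite cuv; apply: c0.
(* The factor [X] excludes [t = 0], because recovering the rescaled equation divides by [t]. *)
have : r * 'X != 0.
  by rewrite mulf_neq0 ?polyX_eq0 //; apply: contraNneq r0 => ->; rewrite horner0.
case/(nonroot_exists Finf) => t; rewrite hornerM hornerX mulf_eq0 negb_or.
case/andP=> rt t0; exists (at_ t) => c mo s0 x xD.
have := Ur t rt (fun x => if x \in cover D then c x else 0) _ x.
rewrite xD; apply=> {x xD}.
have cov x y : adj D x y -> x \in cover D.
  by case/existsP=> f /and3P[fD xf yf]; apply/bigcupP; exists f.
case=> [[x y]|[x|[[x j]|[]]]] /=.
- case: ifP => // xy; rewrite (cov x y xy) (cov y x) ?(adjC D y) //.
  by have [_] := mo x y xy; rewrite !at_E.
- case: ifP => // xx; rewrite (cov x x xx).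
  by have [/(_ erefl)] := mo x x xx; rewrite !at_E.
- case: ifP => [|_]; last by [].
  by case: (boolP (x \in cover D)) => [_|]; rewrite ?mxE // orbF => /s0->; rewrite mxE.
- have vD : adj D v v.
    by case/existsP: uvD => f /and3P[fD uf vf]; apply/existsP; exists f; rewrite fD vf.
  rewrite (cov v v vD) (cov u v uvD) !scaler0 !addr0.
  have [_ e2] := mo u v uvD; have [/(_ erefl) e1 _] := mo v v vD.
  have [/(_ erefl) e0 _] := mo u u uD; move: e0 e1 e2.
  rewrite !at_E /a1 /b !ffunE eqxx (negPf uv) scaler0 addr0 !dotDl !dotZl.
  move=> ->; rewrite add0r => e1 e2; apply: (mulfI t0).
  rewrite mulr0 mulrDr [dot (- _) _]dotC dotNr mulrN [dot (c u) _]dotC.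
  rewrite -[RHS](subrr (0 : F)) -{1}e1 -e2.
  by rewrite opprD addrACA subrr add0r.
- rewrite (cov u u uD) (cov v u) ?(adjC D v) // scaler0 addr0.
  have [_ e1] := mo u v uvD; have [/(_ erefl) e0 _] := mo u u uD; move: e0 e1.
  rewrite !at_E /a1 /b !ffunE eqxx (negPf uv) scaler0 addr0 !dotDl !dotZl.
  by rewrite [dot (- _) _]dotC dotNr [dot (c u) _]dotC => ->; rewrite oppr0.
Qed.

Definition rigid_placement C a := general_position a /\ rigid a C.

Lemma line_open_rigid C s (z : T) : infinite_type F ->
  s \in C -> #|s| = d -> z \notin s -> line_open (rigid_placement C).
Proof.
move=> Finf sC cs zs a b [gp rig].
have [oG _] := @line_open_general_position F T d Finf.
have [|p p0 Up] := line_openI oG (line_open_pinned_rigid (C := C) (s := s)) b (a := a).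
  by split=> //; apply: (pinned_of_rigid gp sC cs zs rig).
exists p => // t /Up[gpt pin]; split=> //.
exact: (rigid_of_pinned gpt sC cs zs pin).
Qed.

Lemma rigid_placement_of_pinned C s (z : T) : infinite_type F ->
    s \in C -> #|s| = d -> z \notin s -> (exists a, pinned_rigid a C s) ->
  exists a, rigid_placement C a.
Proof.
move=> Finf sC cs zs e.
have [oG eG] := @line_open_general_position F T d Finf.
have [a [gp pin]] := line_open_meet Finf oG (line_open_pinned_rigid (C := C) (s := s)) eG e.
by exists a; split=> //; apply: (rigid_of_pinned gp sC cs zs pin).
Qed.
End Splitting.

(** * Cycles modulo 2 and edge contractions *)

Section Chains.
Variable T : finType.
Implicit Types (C D E Z : {set {set T}}) (f g h s Q R : {set T}).

Lemma odd_card (U : finType) (A : {pred U}) : odd #|A| = \big[addb/false]_x (x \in A).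
Proof.
rewrite -sum1_card big_mkcond (big_morph odd oddD (erefl _)).
by apply: eq_bigr => x _; case: (x \in A).
Qed.

(* [bd C] is the indicator function of the boundary modulo 2 of the chain [C]. *)
Definition bd C R := \big[addb/false]_f ((f \in C) && (R \subset f)).

Definition uniform d C := {in C, forall f, #|f| = d}.

Definition is_cycle d C := uniform d C /\ forall R, #|R|.+1 = d -> ~~ bd C R.

Definition minimal_cycle d C := [/\ is_cycle d C, C != set0 &
  forall Z, Z \subset C -> is_cycle d Z -> Z != set0 -> Z = C].

Lemma bdE C R : bd C R = odd #|[set f in C | R \subset f]|.
Proof.
by rewrite odd_card; apply: eq_bigr => f _; rewrite inE.
Qed.

Lemma bd_addb C D E R : (forall f, (f \in E) = (f \in C) (+) (f \in D)) ->
  bd E R = bd C R (+) bd D R.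
Proof.
by move=> HE; rewrite /bd -big_split; apply: eq_bigr => f _; rewrite HE andb_addl.
Qed.

Lemma bd_cofacet d C R (x : T) : uniform d C -> #|R|.+1 = d -> x \notin R ->
  \big[addb/false]_f [&& f \in C, R \subset f & x \in f] = (x |: R \in C).
Proof.
move=> uC cR xR; rewrite (bigD1 (x |: R)) //= subsetUr setU11 andbT andbT.
rewrite big1 ?addbF // => f fR; apply: contraNF fR => /and3P[fC Rf xf].
rewrite eq_sym eqEcard subUset sub1set xf Rf /=.
by rewrite (uC f fC) cardsU1 xR add1n cR.
Qed.

Lemma bd_avoid d C R (x : T) : uniform d C -> #|R|.+1 = d -> x \notin R ->
  \big[addb/false]_f [&& f \in C, R \subset f & x \notin f] =
  bd C R (+) (x |: R \in C).
Proof.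
move=> uC cR xR; rewrite -(bd_cofacet uC cR xR) /bd -big_split.
by apply: eq_bigr => f _; case: (f \in C); case: (R \subset f); case: (x \in f).
Qed.

Lemma cycle_addb d C D E : is_cycle d C -> is_cycle d D ->
  (forall f, (f \in E) = (f \in C) (+) (f \in D)) -> is_cycle d E.
Proof.
move=> [uC cC] [uD cD] HE; split=> [f|R cR].
  by rewrite HE; case: (boolP (f \in C)) => [/uC //|_ /= /uD].
by rewrite (bd_addb R HE) (negPf (cC R cR)) (negPf (cD R cR)).
Qed.

Lemma cycle0 d : is_cycle d set0.
Proof.
split=> [f|R _]; first by rewrite inE.
by rewrite /bd big1 // => f _; rewrite inE.
Qed.

Definition chain_sum (Ds : seq {set {set T}}) :=
  [set f | odd (count (fun D => f \in D) Ds)].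

Lemma cycle_sum d Ds : {in Ds, forall D, is_cycle d D} -> is_cycle d (chain_sum Ds).
Proof.
elim: Ds => [_|D Ds IH cDs].
  by have -> : chain_sum [::] = set0; [apply/setP=> f; rewrite !inE | apply: cycle0].
apply: (@cycle_addb _ D (chain_sum Ds)).
- by apply: cDs; rewrite mem_head.
- by apply: IH => D' D's; apply: cDs; rewrite inE D's orbT.
- by move=> f; rewrite !inE /= oddD oddb.
Qed.

Lemma cycle_setD d C Z : Z \subset C -> is_cycle d C -> is_cycle d Z ->
  is_cycle d (C :\: Z).
Proof.
move=> ZC cC cZ; apply: (cycle_addb cC cZ) => f; rewrite inE.
by have := subsetP ZC f; case: (f \in Z) => [->|]; case: (f \in C).
Qed.

Lemma minimal_cycle_exists d C : is_cycle d C -> C != set0 ->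
  exists2 Z : {set {set T}}, Z \subset C & minimal_cycle d Z.
Proof.
have [k] := ubnP #|C|; elim: k C => // k IH C ltC cC C0.
pose dec (Z : {set {set T}}) :=
  [forall f in Z, #|f| == d] && [forall R : {set T}, (#|R|.+1 == d) ==> ~~ bd Z R].
have decP Z : reflect (is_cycle d Z) (dec Z).
  apply: (iffP andP) => [[/forall_inP u /forallP c]|[u c]].
    by split=> [f /u/eqP //|R /eqP cR]; have := c R; rewrite cR.
  split; first by apply/forall_inP => f /u/eqP.
  by apply/forallP => R; apply/implyP=> /eqP /c.
case: (pickP (fun Z : {set {set T}} => [&& Z \proper C, dec Z & Z != set0])) => [Z|none].
  case/and3P => ZC /decP cZ Z0.
  have [|Z' Z'Z mZ'] := IH Z _ cZ Z0; first exact: leq_trans (proper_card ZC) _.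
  by exists Z' => //; apply: subset_trans Z'Z (proper_sub ZC).
exists C => //; split=> // Z ZC cZ Z0; apply/eqP; move: (none Z).
by rewrite properEneq ZC (introT (decP Z) cZ) Z0 !andbT => /negbFE.
Qed.

(** The boundary of a boundary vanishes: a facet containing [Q] has exactly two further vertices and
    is counted once for each. *)
Lemma bd_one_step d C Q : uniform d C -> #|Q|.+2 = d ->
  \big[addb/false]_(y in ~: Q) bd C (y |: Q) = false.
Proof.
move=> uC cQ; rewrite exchange_big big1 // => f _.
have [fC|_] /= := boolP (f \in C); last by rewrite big1.
have [Qf|Qf] := boolP (Q \subset f); last first.
  by rewrite big1 // => y _; apply: contraNF Qf => /(subset_trans (subsetUr _ _)).
have c2 : #|f :\: Q| = 2%N by rewrite cardsD (setIidPr Qf) (uC f fC) -cQ -addn2 addKn.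
transitivity (odd #|f :\: Q|); last by rewrite c2.
rewrite odd_card big_mkcond; apply: eq_bigr => y _; rewrite !inE subUset sub1set Qf andbT.
by case: (y \in Q).
Qed.

Lemma big_cofaces (P : pred {set T}) R :
  \big[addb/false]_(y in ~: R) P (y |: R) =
  \big[addb/false]_(h : {set T}) [&& R \subset h, #|h| == #|R|.+1 & P h].
Proof.
have inj : {in ~: R &, injective (fun y => y |: R)}.
  move=> x y; rewrite !inE => xR yR /setP/(_ x).
  by rewrite !inE eqxx (negPf xR) !orbF => /esym/eqP.
transitivity (\big[addb/false]_(h in [set y |: R | y in ~: R]) P h).
  by rewrite (big_imset _ inj).
rewrite big_mkcond; apply: eq_bigr => h _; case: ifP => [|hR].
  case/imsetP=> y; rewrite inE => yR ->.
  by rewrite subsetUr cardsU1 yR add1n eqxx.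
apply/esym/negbTE; apply: contraFN hR => /and3P[Rh /eqP ch _].
have /cards1P[y hRy] : #|h :\: R| == 1%N.
  by rewrite cardsD (setIidPr Rh) ch subSn // subnn.
apply/imsetP; exists y.
  by have := set11 y; rewrite -hRy !inE => /andP[].
by rewrite -hRy setUC -{1}(setID h R) (setIidPr Rh).
Qed.
End Chains.

(** * Contracting an edge and lifting cycles back *)

Section Contraction.
Variables (T : finType) (d : nat) (u v : T).
Hypothesis uv : u != v.
Implicit Types (C D E Z : {set {set T}}) (f g h s Q R : {set T}).

Definition swap f := tperm u v @: f.

Lemma in_swap f x : (x \in swap f) = (tperm u v x \in f).
Proof. by rewrite -{1}(tpermK u v x) mem_imset //; apply: perm_inj. Qed.

Lemma swapK : involutive swap.
Proof. by move=> f; apply/setP=> x; rewrite !in_swap tpermK. Qed.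

Lemma swap_u f : (u \in swap f) = (v \in f).
Proof. by rewrite in_swap tpermL. Qed.

Lemma swap_v f : (v \in swap f) = (u \in f).
Proof. by rewrite in_swap tpermR. Qed.

Lemma swap_x f x : x != u -> x != v -> (x \in swap f) = (x \in f).
Proof. by move=> xu xv; rewrite in_swap tpermD // eq_sym. Qed.

Lemma card_swap f : #|swap f| = #|f|.
Proof. exact/card_imset/perm_inj. Qed.

Lemma swap_subset f g : (swap f \subset swap g) = (f \subset g).
Proof.
apply/subsetP/subsetP => fg x; last by rewrite !in_swap => /fg.
by have := fg (tperm u v x); rewrite !in_swap tpermK.
Qed.

Lemma swap_id f : u \notin f -> v \notin f -> swap f = f.
Proof.
move=> uf vf; apply/setP => x; have [->|xu] := eqVneq x u.
  by rewrite swap_u (negPf uf) (negPf vf).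
have [->|xv] := eqVneq x v; first by rewrite swap_v (negPf uf) (negPf vf).
by rewrite swap_x.
Qed.

Lemma setU1_swap f : u \in f -> v \notin f -> u |: swap f = v |: f.
Proof.
move=> uf vf; apply/setP => x; rewrite in_setU1 [in RHS]in_setU1.
have [->|xu] := eqVneq x u; first by rewrite uf orbT.
by have [->|xv] := eqVneq x v; [rewrite swap_v uf | rewrite swap_x].
Qed.

(* The image modulo 2 of the chain [E] under the contraction [v |-> u]. *)
Definition push E :=
  [set g : {set T} | (v \notin g) && ((g \in E) (+) ((u \in g) && (swap g \in E)))].

Lemma in_push E g :
  (g \in push E) = (v \notin g) && ((g \in E) (+) ((u \in g) && (swap g \in E))).
Proof. by rewrite inE. Qed.

(** The contraction is a chain map. Leaving out the facets through [v] produces the error term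
    [v |: R \in E]; the facets moved by [swap] produce the same term, and the two cancel. *)
Lemma bd_push E R : uniform d E -> #|R|.+1 = d -> v \notin R ->
  bd (push E) R = bd E R (+) ((u \in R) && bd E (swap R)).
Proof.
move=> uE cR vR.
have -> : bd (push E) R = \big[addb/false]_f [&& f \in E, R \subset f & v \notin f]
   (+) \big[addb/false]_f [&& f \in E, swap R \subset f, u \notin f & v \in f].
  rewrite [X in _ (+) X](reindex_inj (inv_inj swapK)) -big_split.
  apply: eq_bigr => f _; rewrite inE swap_u swap_v swap_subset.
  by case: (f \in E); case: (swap f \in E); case: (R \subset f);
     case: (u \in f); case: (v \in f).
rewrite (bd_avoid uE cR vR) -addbA; congr (_ (+) _).
have [uR|uR] /= := boolP (u \in R).
  have uRs : u \notin swap R by rewrite swap_u.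
  rewrite -(setU1_swap uR vR) addbC.
  rewrite -[RHS](addbK (u |: swap R \in E)) -(bd_avoid uE) ?card_swap //.
  congr (_ (+) _); apply: eq_bigr => f _.
  have [sRf|_] := boolP (swap R \subset f); last by rewrite !andbF.
  by rewrite (subsetP sRf v) ?swap_v // andbT.
rewrite swap_id // -(bd_cofacet uE cR vR) -big_split big1 // => f _ /=.
have [fE|//] := boolP (f \in E); have [Rf|//] := boolP (R \subset f).
have [vf|_] /= := boolP (v \in f); last by rewrite andbF.
have [uf|//] := boolP (u \in f).
suff : (#|u |: (v |: R)| <= #|f|)%N.
  by rewrite !cardsU1 !inE (negPf uv) (negPf uR) vR !add1n cR (uE f fE) ltnn.
by apply: subset_leq_card; rewrite !subUset !sub1set uf vf.
Qed.

Lemma cycle_push C : is_cycle d C -> is_cycle d (push C).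
Proof.
move=> [uC cC]; split=> [f|R cR].
  rewrite inE => /andP[_]; case: (boolP (f \in C)) => [/uC//|_ /andP[_ /uC]].
  by rewrite card_swap.
have [vR|vR] := boolP (v \in R).
  rewrite /bd big1 // => f _; rewrite inE; apply: contraTF vR => /andP[/andP[vf _] Rf].
  by apply: contraNN vf; apply: (subsetP Rf).
rewrite bd_push // (negPf (cC R cR)) (negPf (cC (swap R) _)) ?card_swap //.
by rewrite andbF.
Qed.

(** For [Z] inside [push C], each facet of [Z] has exactly one preimage here, because facets of [C]
    with equal images cancel in [push C]. *)
Definition lift_chain C Z :=
  [set f in C | if v \in f then (u \notin f) && (swap f \in Z) else f \in Z].

Lemma lift_chain_avoid C Z f : f \in lift_chain C Z -> (u \in f) && (v \in f) = false.
Proof. by rewrite inE => /andP[_]; case: (v \in f) => [/andP[/negPf->]|]; rewrite ?andbF. Qed.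

Lemma push_lift_chain C Z : Z \subset push C -> push (lift_chain C Z) = Z.
Proof.
move=> ZC; apply/setP => g; rewrite !inE swap_u swap_v swapK.
have [gZ|/negPf gZ] := boolP (g \in Z).
  have := subsetP ZC g gZ; rewrite inE => /andP[vg]; rewrite vg (negPf vg) /=.
  by case: (g \in C); case: (u \in g); case: (swap g \in C).
by case: (v \in g); case: (u \in g); rewrite ?andbF.
Qed.

(** The lifted chain need not be closed: its boundary ridges are exchanged in pairs by [swap]. The
    union of such a pair is a facet through [uv] that cancels both; it need not belong to [C]. *)
Definition lift_uv C Z :=
  [set h : {set T} | [&& u \in h, v \in h, #|h| == d & bd (lift_chain C Z) (h :\ v)]].

Definition lift_cycle C Z := lift_chain C Z :|: lift_uv C Z.

Lemma lift_cycleE C Z f : (f \in lift_cycle C Z) =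
  (f \in lift_chain C Z) (+) (f \in lift_uv C Z).
Proof.
rewrite in_setU; have := @lift_chain_avoid C Z f; case: (f \in lift_chain C Z) => // /(_ isT).
by rewrite [f \in lift_uv _ _]inE andbA => ->.
Qed.

Lemma uniform_lift_chain C Z : uniform d C -> uniform d (lift_chain C Z).
Proof. by move=> uC f; rewrite inE => /andP[/uC]. Qed.

(** The boundary of the lift is pushed to that of [Z], which is zero, so [R] and [swap R] carry
    equal coefficients. *)
Lemma bd_lift_swap C Z R : uniform d C -> is_cycle d Z -> Z \subset push C ->
    #|R|.+1 = d -> u \in R -> v \notin R ->
  bd (lift_chain C Z) (swap R) = bd (lift_chain C Z) R.
Proof.
move=> uC [_ cZ] ZC cR uR vR; have := cZ R cR.
rewrite -(push_lift_chain ZC) bd_push ?uR //=; last exact: uniform_lift_chain.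
by rewrite push_lift_chain //; case: (bd _ R); case: (bd _ (swap R)).
Qed.

Lemma setD1_swap h : u \in h -> v \in h -> h :\ u = swap (h :\ v).
Proof.
move=> uh vh; apply/setP => x; have [->|xu] := eqVneq x u.
  by rewrite swap_u !inE !eqxx.
have [->|xv] := eqVneq x v; first by rewrite swap_v !inE vh uh uv eq_sym uv.
by rewrite swap_x // !inE xu xv.
Qed.

Lemma cycle_lift C Z : uniform d C -> is_cycle d Z -> Z \subset push C ->
  is_cycle d (lift_cycle C Z).
Proof.
move=> uC cycZ ZC; have [uZ cZ] := cycZ; have uL := uniform_lift_chain (Z := Z) uC.
have uX : uniform d (lift_uv C Z) by move=> f; rewrite inE => /and4P[_ _ /eqP].
split=> [f|R cR]; first by rewrite in_setU => /orP[/uL|/uX].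
rewrite (bd_addb R (lift_cycleE C Z)).
have [uR|uR] := boolP (u \in R); have [vR|vR] := boolP (v \in R).
(* No facet of the lifted chain contains [uv]; the added facets over [R] cancel because the boundary
   of the boundary vanishes at [R :\ v]. *)
- have bdR : bd (lift_chain C Z) R = false.
    rewrite /bd big1 // => f _; apply/andP=> -[/lift_chain_avoid + Rf].
    by rewrite !(subsetP Rf).
  rewrite bdR addFb; apply/negbT.
  transitivity (\big[addb/false]_(y in ~: R) bd (lift_chain C Z) ((y |: R) :\ v)).
    rewrite (big_cofaces (fun h => bd (lift_chain C Z) (h :\ v))) cR.
    apply: eq_bigr => h _; rewrite inE.
    have [Rh|] := boolP (R \subset h); last by rewrite !andbF.
    by rewrite !(subsetP Rh) //= andbT.
  rewrite -[RHS](bd_one_step (Q := R :\ v) uL); last first.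
    by rewrite -cR (cardsD1 v R) vR add1n.
  rewrite big_mkcond [RHS]big_mkcond; apply: eq_bigr => y _.
  have [->|yv] := eqVneq y v; first by rewrite !inE eqxx vR setD1K.
  rewrite !inE yv /= setDUl; case: ifP => // _; congr (bd _ (_ :|: _)).
  by apply/setDidPl; rewrite disjoints1 inE.
- rewrite (_ : bd (lift_uv C Z) R = (v |: R \in lift_uv C Z)); last first.
    rewrite -(bd_cofacet uX cR vR); apply: eq_bigr => f _; rewrite inE.
    by case: (v \in f); rewrite ?andbT ?andbF.
  rewrite inE setU1K // !in_setU1 uR eqxx orbT /= cardsU1 vR add1n cR eqxx /=.
  by rewrite addbb.
- rewrite (_ : bd (lift_uv C Z) R = (u |: R \in lift_uv C Z)); last first.
    rewrite -(bd_cofacet uX cR uR); apply: eq_bigr => f _; rewrite inE.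
    by case: (u \in f); rewrite ?andbT ?andbF.
  have hv : (u |: R) :\ v = swap R.
    rewrite -{2}(setU1K uR) setD1_swap ?swapK ?setU11 //.
    by rewrite in_setU1 vR orbT.
  rewrite inE hv !in_setU1 vR eqxx orbT /= cardsU1 uR add1n cR eqxx /=.
  by rewrite -(@bd_lift_swap C Z (swap R)) ?swapK ?addbb ?card_swap ?swap_u ?swap_v.
- rewrite (_ : bd (lift_uv C Z) R = false) ?addbF; last first.
    rewrite /bd big1 // => f _; rewrite inE; apply/negbTE/negP.
    case/andP=> /and4P[uf vf /eqP cf _] Rf.
    suff : (#|u |: (v |: R)| <= #|f|)%N.
      by rewrite !cardsU1 !inE (negPf uv) (negPf uR) vR !add1n cR cf ltnn.
    by apply: subset_leq_card; rewrite !subUset !sub1set uf vf.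
  by have := cZ R cR; rewrite -{1}(push_lift_chain ZC) bd_push // (negPf uR) addbF.
Qed.
End Contraction.

(** * Decomposing a cycle along a contracted edge *)

Section Decomposition.
Variables (T : finType) (d : nat).
Implicit Types (C D E Z : {set {set T}}) (f g h s Q R W : {set T}).

Lemma adjP C x y : reflect (exists2 f, f \in C & (x \in f) && (y \in f)) (adj C x y).
Proof.
apply: (iffP existsP) => [[f /andP[fC xyf]]|[f fC xyf]]; exists f => //.
by rewrite fC.
Qed.

Lemma adj_cover C x y : adj C x y -> x \in cover C.
Proof. by case/adjP => f fC /andP[xf _]; apply/bigcupP; exists f. Qed.

Lemma bd_exists C R : bd C R -> exists2 f, f \in C & R \subset f.
Proof.
move=> bdR; case: (pickP (fun f => (f \in C) && (R \subset f))) => [f /andP[]|none].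
  by exists f.
by move: bdR; rewrite /bd big1.
Qed.

Lemma cycle_other_facet C h R : is_cycle d C -> h \in C -> R \subset h ->
  #|R|.+1 = d -> exists2 f, f \in C & (R \subset f) && (f != h).
Proof.
move=> [_ cC] hC Rh cR.
case: (pickP (fun f => [&& f \in C, R \subset f & f != h])) => [f /and3P[]|none].
  by move=> fC Rf fh; exists f; rewrite ?Rf.
case/negP: (cC R cR); rewrite /bd (bigD1 h) //= hC Rh big1 // => f fh.
by have := none f; rewrite fh andbT.
Qed.

(** A facet and its neighbour across a ridge already have more than [d] vertices. The spare vertex
    completes a facet to the [d + 1] points that general position speaks of. *)
Lemma cycle_facet_complement C s : is_cycle d C -> C != set0 -> (0 < d)%N ->
  #|s| = d -> exists z, z \notin s.
Proof.
move=> cycC /set0Pn[h hC] d0 cs; have [uC _] := cycC.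
have ltT : (d < #|T|)%N.
  have /card_gt0P[x xh] : (0 < #|h|)%N by rewrite (uC h hC).
  have cx : #|h :\ x|.+1 = d by rewrite -(uC h hC) (cardsD1 x h) xh.
  have [f fC /andP[hf fh]] := cycle_other_facet cycC hC (subsetDl h [set x]) cx.
  apply: leq_trans (max_card (mem (h :|: f))).
  rewrite -(uC h hC); apply: proper_card; rewrite properE subsetUl /=.
  apply: contra fh => /subsetP hfh; rewrite eqEcard !uC // leqnn andbT.
  by apply/subsetP => y yf; apply: hfh; rewrite inE yf orbT.
have /card_gt0P[z] : (0 < #|~: s|)%N by rewrite cardsCs setCK cs subn_gt0.
by rewrite inE; exists z.
Qed.

(** Vertex splitting needs [d - 1] common neighbours and [h] supplies [d - 2]. As [d >= 3], some [x]
    in [h] differs from [u] and [v], and the facet across the ridge [h :\ x] supplies the last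
    one. *)
Lemma common_neighbors C h u v : (3 <= d)%N -> u != v -> is_cycle d C ->
    h \in C -> u \in h -> v \in h ->
  exists W, [/\ #|W|.+1 = d, u \notin W, v \notin W &
    {in W, forall w, adj C u w && adj C v w}].
Proof.
move=> d3 uv cycC hC uh vh; have [uC _] := cycC.
have cF : #|h :\ u :\ v|.+2 = d.
  rewrite -(uC h hC) (cardsD1 u h) uh (cardsD1 v (h :\ u)) !inE vh eq_sym uv.
  by rewrite !add1n.
have /card_gt0P[x] : (0 < #|h :\ u :\ v|)%N by rewrite -2!ltnS cF.
rewrite !inE => /and3P[xv xu xh].
have cR : #|h :\ x|.+1 = d by rewrite -(uC h hC) (cardsD1 x h) xh.
have [f fC /andP[Rf fh]] := cycle_other_facet cycC hC (subsetDl h [set x]) cR.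
have [y yf yh] : exists2 y, y \in f & y \notin h.
  apply/subsetPn; apply: contra fh => fsub; rewrite eqEcard fsub.
  by rewrite !uC /=.
have [uf vf] : u \in f /\ v \in f.
  by split; apply: (subsetP Rf); rewrite !inE ?uh ?vh eq_sym ?xu ?xv.
exists (y |: (h :\ u :\ v)); split.
- by rewrite cardsU1 !inE (negPf yh) !andbF add1n.
- rewrite !inE negb_or eqxx andbF andbT /= ?andbT.
  by apply: contraNneq yh => <-.
- rewrite !inE negb_or eqxx andbT.
  by apply: contraNneq yh => <-.
- move=> w; rewrite !inE => /predU1P[->|/and3P[_ _ wh]].
    by apply/andP; split; apply/adjP; exists f; rewrite ?uf ?vf.
  by apply/andP; split; apply/adjP; exists h; rewrite ?uh ?vh.
Qed.

Section Lift.
Variables (u v : T).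
Hypothesis uv : u != v.
Local Notation swap := (swap u v).
Local Notation push := (push u v).
Local Notation lift_chain := (lift_chain u v).
Local Notation lift_uv := (lift_uv d u v).
Local Notation lift_cycle := (lift_cycle d u v).

Lemma lift_chain_cover C Z f x : f \in lift_chain C Z -> x \in f -> x != v ->
  x \in cover Z.
Proof.
rewrite inE => /andP[_]; case: ifP => [_ /andP[uf fZ]|_ fZ] xf xv.
  apply/bigcupP; exists (swap f) => //; rewrite swap_x //.
  by apply: contraNneq uf => <-.
by apply/bigcupP; exists f.
Qed.

Lemma lift_cycle_cover C Z : cover (lift_cycle C Z) \subset v |: cover Z.
Proof.
apply/subsetP => x /bigcupP[f]; rewrite !inE => fL xf.
have [//|xv /=] := eqVneq x v.
case/orP: fL => [fL|/and4P[_ _ _ /bd_exists[g gL hg]]].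
  by apply: lift_chain_cover xv; [rewrite inE; exact: fL|].
apply: (lift_chain_cover gL) => //; apply: (subsetP hg).
by rewrite !inE xv.
Qed.

(** In an added facet, a pair omitting [v] or [u] lies in a ridge of some lifted facet, which
    belongs to [C]; the remaining pair is [uv] itself. *)
Lemma lift_cycle_adj C Z x y : uniform d C -> is_cycle d Z -> Z \subset push C ->
  adj C u v -> adj (lift_cycle C Z) x y -> adj C x y.
Proof.
move=> uC cycZ ZC uvC /adjP[f]; rewrite in_setU => /orP[|fX].
  by rewrite inE => /andP[fC _] xyf; apply/adjP; exists f.
move: (fX); rewrite inE => /and4P[uf vf /eqP cf bdf] /andP[xf yf].
have via w : w \in f -> bd (lift_chain C Z) (f :\ w) ->
    x != w -> y != w -> adj C x y.
  move=> wf /bd_exists[g]; rewrite inE => /andP[gC _] /subsetP fg xw yw.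
  by apply/adjP; exists g => //; rewrite !fg // !inE ?xw ?yw.
have bdu : bd (lift_chain C Z) (f :\ u).
  rewrite (setD1_swap uv uf vf) (bd_lift_swap uv uC cycZ ZC) //.
  - by rewrite -cf (cardsD1 v f) vf.
  - by rewrite !inE uv.
  - by rewrite !inE eqxx.
have [xv|xv] := eqVneq x v; last first.
  have [yv|yv] := eqVneq y v; last exact: via v _ _ _ _.
  have [xu|xu] := eqVneq x u; first by rewrite xu yv.
  by apply: (via u) => //; rewrite yv eq_sym.
have [yu|yu] := eqVneq y u; first by rewrite xv yu adjC.
by apply: (via u) => //; rewrite xv eq_sym.
Qed.

Lemma adj_lift C Z x y : Z \subset push C -> x != u -> y != u -> adj Z x y ->
  adj (lift_cycle C Z) x y.
Proof.
move=> ZC xu yu /adjP[g gZ /andP[xg yg]].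
have vg : v \notin g by have := subsetP ZC g gZ; rewrite inE => /andP[].
move: (gZ); rewrite -{1}(push_lift_chain ZC) in_push vg /= => gL.
have [gL'|gL'] := boolP (g \in lift_chain C Z).
  by apply/adjP; exists g; rewrite ?xg ?yg // in_setU gL'.
rewrite (negPf gL') /= in gL; have [ug sL] := andP gL.
apply/adjP; exists (swap g); first by rewrite in_setU sL.
by rewrite !swap_x ?xg ?yg //; apply: contraNneq vg => <-.
Qed.

Lemma adj_lift_u C Z y : Z \subset push C -> y != u -> adj Z u y ->
  adj (lift_cycle C Z) u y || adj (lift_cycle C Z) v y.
Proof.
move=> ZC yu /adjP[g gZ /andP[ug yg]].
have vg : v \notin g by have := subsetP ZC g gZ; rewrite inE => /andP[].
move: (gZ); rewrite -{1}(push_lift_chain ZC) in_push vg /= => gL.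
have [gL'|gL'] := boolP (g \in lift_chain C Z).
  by apply/orP; left; apply/adjP; exists g; rewrite ?ug ?yg // in_setU gL'.
rewrite (negPf gL') /= in gL; have [_ sL] := andP gL.
apply/orP; right; apply/adjP; exists (swap g); first by rewrite in_setU sL.
by rewrite swap_v ug swap_x ?yg //; apply: contraNneq vg => <-.
Qed.

Lemma facet_lift C Z s' : Z \subset push C -> s' \in Z ->
  exists2 s, s \in lift_cycle C Z &
    {in s', forall x, if x == u then (u \in s) || (v \in s) else x \in s}.
Proof.
move=> ZC gZ.
have vg : v \notin s' by have := subsetP ZC s' gZ; rewrite inE => /andP[].
move: (gZ); rewrite -{1}(push_lift_chain ZC) in_push vg /= => gL.
have [gL'|gL'] := boolP (s' \in lift_chain C Z).
  exists s' => [|x xs]; first by rewrite in_setU gL'.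
  by case: eqP => [<-|]; rewrite ?xs.
rewrite (negPf gL') /= in gL; have [us sL] := andP gL.
exists (swap s') => [|x xs]; first by rewrite in_setU sL.
have [_|xu] := eqVneq x u; first by rewrite swap_v us orbT.
by rewrite swap_x //; apply: contraNneq vg => <-.
Qed.

(** Provides the decreasing measure of the induction: contraction loses [v] and creates no
    vertex. *)
Lemma push_cover C Z : Z \subset push C -> adj C u v -> cover Z \proper cover C.
Proof.
move=> ZC uvC; have vZ : v \notin cover Z.
  apply/negP => /bigcupP[g gZ vg].
  by have := subsetP ZC g gZ; rewrite inE vg.
rewrite properE; apply/andP; split; last first.
  by apply: contraNN vZ => /subsetP; apply; apply: (@adj_cover _ _ u); rewrite adjC.
apply/subsetP => x /bigcupP[g gZ xg].
have := subsetP ZC g gZ; rewrite inE => /andP[vg].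
have [gC _|_ /andP[ug sC]] := boolP (g \in C); first by apply/bigcupP; exists g.
have [->|xu] := eqVneq x u; first exact: adj_cover uvC.
apply/bigcupP; exists (swap g) => //; rewrite swap_x //.
by apply: contraNneq vg => <-.
Qed.

(* Without a facet through [uv], the lift of [Z] would be a subcycle of [C],
   hence equal to [C]. *)
Lemma lift_uv_exists C Z : minimal_cycle d C -> adj C u v -> Z \subset push C ->
  is_cycle d Z -> Z != set0 -> exists h, h \in lift_uv C Z.
Proof.
move=> [[uC _] _ minC] /adjP[f fC uvf] ZC cycZ Z0.
apply/set0Pn/eqP => X0; have := cycle_lift uv uC cycZ ZC.
rewrite /lift_cycle X0 setU0 => cycL.
have LC : lift_chain C Z \subset C by apply/subsetP => g; rewrite inE => /andP[].
have L0 : lift_chain C Z != set0.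
  apply: contraNneq Z0 => L0; rewrite -(push_lift_chain ZC) L0.
  by apply/eqP/setP => g; rewrite !inE andbF andbF.
move: fC; rewrite -(minC _ LC cycL L0) => /lift_chain_avoid.
by rewrite uvf.
Qed.

Lemma lift_rigid (F : fieldType) C Z : infinite_type F -> (3 <= d)%N ->
    minimal_cycle d C -> adj C u v -> Z \subset push C -> minimal_cycle d Z ->
    (exists a, @rigid_placement F T d Z a) ->
  exists a, @rigid_placement F T d (lift_cycle C Z) a.
Proof.
move=> Finf d3 minC uvC ZC [cycZ Z0 _] [a0 [gp rig]].
have [[uC _] _ _] := minC; have [uZ _] := cycZ.
have cycL := cycle_lift uv uC cycZ ZC; have [uL _] := cycL.
have d0 : (0 < d)%N by apply: leq_trans d3.
(* The facet [h] provides the edge [uv] and the common neighbours in the lift, and shows that [u] is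
   a vertex of [Z]. *)
have [h hX] := lift_uv_exists minC uvC ZC cycZ Z0.
have hL : h \in lift_cycle C Z by rewrite in_setU hX orbT.
move: hX; rewrite inE => /and4P[uh vh _ /bd_exists[f fL hf]].
have uf : u \in f by apply: (subsetP hf); rewrite !inE uv.
have [s' s'Z] := set0Pn _ Z0; have [s sL ss'] := facet_lift ZC s'Z.
have [z' z's'] := cycle_facet_complement cycZ Z0 d0 (uZ _ s'Z).
have L0 : lift_cycle C Z != set0 by apply/set0Pn; exists s.
have [z zs] := cycle_facet_complement cycL L0 d0 (uL _ sL).
have [W [cW uW vW WL]] := common_neighbors d3 uv cycL hL uh vh.
apply: (rigid_placement_of_pinned Finf sL (uL _ sL) zs).
apply: (vertex_split (u := u) (v := v) (W := W) (s' := s') (Z := Z) Finf gp uv) => //.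
- apply/negP => /bigcupP[g gZ vg].
  by have := subsetP ZC g gZ; rewrite inE vg.
- exact: (lift_chain_cover fL uf uv).
- exact: lift_cycle_cover.
- by apply/adjP; exists h; rewrite ?uh ?vh.
- by move=> x y xu yu; apply: adj_lift.
- by move=> y; apply: adj_lift_u.
- exact: (pinned_of_rigid gp s'Z (uZ _ s'Z) z's' rig).
Qed.

(** Minimal cycles are split off [Z] one at a time. Lifting is additive away from [uv], because all
    closing facets contain [uv]. *)
Lemma lift_chain_decomposition (P : {set {set T}} -> Prop) C Z :
    is_cycle d Z -> Z \subset push C ->
    (forall Z', Z' \subset push C -> minimal_cycle d Z' -> P (lift_cycle C Z')) ->
  exists2 Ds : seq {set {set T}}, {in Ds, forall D, P D} &
    forall f, ~~ ((u \in f) && (v \in f)) ->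
      (f \in lift_chain C Z) = odd (count (fun D => f \in D) Ds).
Proof.
move=> cycZ ZC PL; have [k] := ubnP #|Z|; elim: k Z cycZ ZC => // k IH Z cycZ ZC ltZ.
have [Z0|Z0] := eqVneq Z set0.
  exists [::] => // f _; rewrite Z0 !inE; case: (f \in C) => //=.
  by case: ifP => // _; rewrite andbF.
have [Z1 Z1Z minZ1] := minimal_cycle_exists cycZ Z0.
have [cycZ1 Z10 _] := minZ1.
have [||Ds PDs EDs] := IH _ (cycle_setD Z1Z cycZ cycZ1).
- exact: subset_trans (subsetDl _ _) ZC.
- rewrite -ltnS; apply: leq_trans ltZ; rewrite ltnS; apply: proper_card.
  rewrite properEneq subsetDl andbT; apply: contraNneq Z10 => E.
  apply/eqP/setP => g; rewrite inE; apply/negP => gZ1.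
  by have := subsetP Z1Z g gZ1; rewrite -E inE gZ1.
exists (lift_cycle C Z1 :: Ds) => [D|f uvf].
  by rewrite inE => /predU1P[->|/PDs//]; apply: PL => //; apply: subset_trans Z1Z ZC.
rewrite /= oddD oddb -EDs // lift_cycleE.
have -> : (f \in lift_uv C Z1) = false.
  by rewrite inE andbA (negPf uvf).
have sub g : (g \in Z1) ==> (g \in Z) by apply/implyP/(subsetP Z1Z).
rewrite addbF !inE; have := sub f; have := sub (swap f).
by case: (f \in C); case: (v \in f); case: (u \in f); case: (f \in Z1);
   case: (f \in Z); case: (swap f \in Z1); case: (swap f \in Z).
Qed.

Definition simplex_boundary s := [set f : {set T} | (f \subset s) && (#|f| == d)].

Lemma cycle_simplex_boundary s : #|s| = d.+1 -> is_cycle d (simplex_boundary s).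
Proof.
move=> cs; split=> [f|R cR]; first by rewrite inE => /andP[_ /eqP].
have [Rs|Rs] := boolP (R \subset s); last first.
  rewrite /bd big1 // => f _; rewrite inE; apply: contraNF Rs => /andP[/andP[fs _]].
  by move/subset_trans; apply.
have -> : bd (simplex_boundary s) R = \big[addb/false]_(y in ~: R) (y |: R \subset s).
  rewrite (big_cofaces (fun h => h \subset s)) cR; apply: eq_bigr => f _.
  by rewrite inE; case: (f \subset s); rewrite ?andbF //= ?andbT andbC.
have c2 : #|s :\: R| = 2%N.
  by rewrite cardsD (setIidPr Rs) cs -cR -addn2 addKn.
suff -> : \big[addb/false]_(y in ~: R) (y |: R \subset s) = odd #|s :\: R| by rewrite c2.
rewrite odd_card big_mkcond; apply: eq_bigr => y _.
by rewrite !inE subUset sub1set Rs andbT; case: (y \in R).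
Qed.

(* The pairs [g], [swap g] of facets that cancel under the contraction. *)
Definition cancelling C := [set g in C | [&& u \in g, v \notin g & swap g \in C]].

(** In the simplex on [v |: g], every facet other than [g] and [swap g] contains both [u] and
    [v]. *)
Lemma cancelling_decomposition C f : uniform d C -> ~~ ((u \in f) && (v \in f)) ->
  odd (count (fun D => f \in D)
    [seq simplex_boundary (v |: g) | g <- enum (cancelling C)]) =
  if v \in f then swap f \in cancelling C else f \in cancelling C.
Proof.
move=> uC uvf; set g0 := if v \in f then swap f else f.
have -> : (if v \in f then swap f \in cancelling C else f \in cancelling C) =
    (g0 \in cancelling C) by rewrite /g0; case: ifP.
rewrite count_map -[g0 \in _]mem_enum -[RHS]oddb -count_uniq_mem ?enum_uniq //.
congr odd; apply: eq_in_count => g; rewrite mem_enum inE => /and4P[gC ug vg sgC] /=.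
have cg := uC g gC.
rewrite inE /g0; case: ifP uvf => [vf|vf]; rewrite ?andbT ?andbF => uf.
  apply/andP/eqP => [[fg /eqP cf]|fg].
    apply: (inv_inj (swapK u v)); rewrite swapK.
    apply/esym/eqP; rewrite eqEcard card_swap cf cg leqnn andbT.
    apply/subsetP => x xf; have [xv|xv] := eqVneq x v; first by rewrite xv swap_v.
    rewrite swap_x //; last by apply: contraNneq uf => <-.
    by have := subsetP fg x xf; rewrite !inE (negPf xv).
  rewrite -[f](swapK u v) -fg card_swap cg eqxx; split=> //.
  by rewrite -(setU1_swap ug vg) subsetUr.
apply/andP/eqP => [[fg /eqP cf]|<-]; last by rewrite subsetUr cg eqxx.
apply/esym/eqP; rewrite eqEcard cf cg leqnn andbT; apply/subsetP => x xf.
have := subsetP fg x xf; rewrite !inE => /predU1P[xv|//].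
by rewrite -xv xf in vf.
Qed.

(* Off the facets through [uv] this is a case check; the difference of the two
   sides is a cycle, and a cycle all of whose facets contain [v] vanishes. *)
Lemma fogelsanger_decomposition (P : {set {set T}} -> Prop) C :
    is_cycle d C -> (0 < d)%N ->
    (forall Z, Z \subset push C -> minimal_cycle d Z -> P (lift_cycle C Z)) ->
    (forall g, g \in cancelling C -> P (simplex_boundary (v |: g))) ->
    (forall D, P D -> is_cycle d D) ->
  exists2 Ds : seq {set {set T}}, {in Ds, forall D, P D} & C = chain_sum Ds.
Proof.
move=> cycC d0 PL PS cycP; have [uC _] := cycC.
have [Ds PDs EDs] := lift_chain_decomposition (cycle_push uv cycC) (subxx _) PL.
pose Ds' := [seq simplex_boundary (v |: g) | g <- enum (cancelling C)].
have PDD : {in Ds ++ Ds', forall D, P D}.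
  move=> D; rewrite mem_cat => /orP[/PDs//|/mapP[g]]; rewrite mem_enum => gC ->.
  exact: PS.
exists (Ds ++ Ds') => //.
pose Y := [set f | (f \in C) (+) (f \in chain_sum (Ds ++ Ds'))].
have cycY : is_cycle d Y.
  apply: (cycle_addb cycC (cycle_sum _)) => [D /PDD/cycP|f]; first by [].
  by rewrite in_set.
have Yuv f : f \in Y -> (u \in f) && (v \in f).
  rewrite in_set in_set count_cat oddD; apply: contraTT => uvf.
  rewrite -EDs // cancelling_decomposition // !inE swap_u swap_v swapK.
  move: uvf; case: (f \in C); case: (v \in f); case: (u \in f);
    case: (swap f \in C) => //.
have Y0 : Y = set0.
  apply/eqP; apply: contraTT isT => /set0Pn[f fY].
  have /andP[_ vf] := Yuv f fY; have [uY _] := cycY.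
  have cR : #|f :\ v|.+1 = d by rewrite -(uY f fY) (cardsD1 v f) vf.
  have [g gY /andP[fg gf]] := cycle_other_facet cycY fY (subsetDl f [set v]) cR.
  case/eqP: gf; apply/esym/eqP; rewrite eqEcard !uY // leqnn andbT.
  have /andP[_ vg] := Yuv g gY.
  by rewrite -(setD1K vf) subUset sub1set vg.
apply/setP => f; have := in_set0 f; rewrite -Y0 in_set.
by case: (f \in C); case: (f \in chain_sum _).
Qed.
End Lift.
End Decomposition.

(** * Fogelsanger's theorem *)

Section Fogelsanger.
Variables (F : fieldType) (T : finType) (d : nat).
Implicit Types (C D Z : {set {set T}}) (a : {ffun T -> 'rV[F]_d.+1}).

(* The summands on which a motion is given by the same matrix sum up to a
   subcycle of [C], because summands with different matrices share no facet. *)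
Lemma rigid_chain_sum a C (Ds : seq {set {set T}}) : (0 < d)%N ->
    general_position a -> minimal_cycle d C -> C = chain_sum Ds ->
    {in Ds, forall D, [/\ is_cycle d D, forall x y, adj D x y -> adj C x y
                        & rigid a D]} ->
  rigid a C.
Proof.
move=> d0 gp [cycC C0 minC] CE HDs c mo.
have : forall D, exists A : 'M[F]_d.+1, D \in Ds ->
    alternating A /\ {in cover D, forall v, c v = a v *m A}.
  move=> D; have [DDs|] := boolP (D \in Ds); last by exists 0.
  have [_ DC rig] := HDs D DDs.
  have [|A altA EA] := rig c; first by move=> x y /DC/mo.
  by exists A.
case/fin_all_exists => M MP.
have shared D D' f : D \in Ds -> D' \in Ds -> f \in D -> f \in D' -> M D = M D'.
  move=> DDs D'Ds fD fD'; have [cycD _ _] := HDs D DDs; have [uD _] := cycD.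
  have D0 : D != set0 by apply/set0Pn; exists f.
  have [z zf] := cycle_facet_complement cycD D0 d0 (uD f fD).
  have [altD ED] := MP D DDs; have [altD' ED'] := MP D' D'Ds.
  apply/eqP; rewrite -subr_eq0; apply/eqP.
  apply: (alternating_eq0 gp (uD f fD) zf) => [x|x xf].
    by rewrite mulmxBr dotDr dotNr altD altD' subr0.
  rewrite mulmxBr -ED -?ED' ?subrr //; apply/bigcupP; by exists f.
have [f0 f0C] := set0Pn _ C0.
have countP f : f \in C -> exists2 D, D \in Ds & f \in D.
  rewrite CE inE => oddf; apply/hasP; rewrite has_count.
  by case: (count _ _) oddf.
have [D0 D0Ds f0D0] := countP f0 f0C.
pose Ds' := [seq D <- Ds | M D == M D0].
have count_sel f D : D \in Ds -> f \in D -> M D = M D0 ->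
    (f \in chain_sum Ds') = (f \in C).
  move=> DDs fD MD; rewrite CE !inE count_filter; congr odd.
  apply: eq_in_count => D' D'Ds /=; have [fD'|//] := boolP (f \in D').
  by rewrite -MD (shared D' D f) ?eqxx.
have Ds'P D : D \in Ds' -> D \in Ds /\ M D = M D0.
  by rewrite mem_filter => /andP[/eqP].
have sub f : f \in chain_sum Ds' -> exists2 D, D \in Ds' & f \in D.
  rewrite inE => oddf; apply/hasP; rewrite has_count.
  by case: (count _ _) oddf.
have CE' : chain_sum Ds' = C.
  apply: minC.
  - apply/subsetP => f fZ; have [D /Ds'P[DDs MD] fD] := sub f fZ.
    by rewrite -(count_sel f D).
  - by apply: cycle_sum => D /Ds'P[/HDs[]].
  - by apply/set0Pn; exists f0; rewrite (count_sel f0 D0).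
exists (M D0) => [|v /bigcupP[f]]; first by have [] := MP D0 D0Ds.
rewrite -{1}CE' => /sub[D /Ds'P[DDs <-] fD] vf.
by have [_] := MP D DDs; apply; apply/bigcupP; exists f.
Qed.

Theorem minimal_cycle_rigid C : infinite_type F -> (3 <= d)%N ->
  minimal_cycle d C -> exists a, @rigid_placement F T d C a.
Proof.
move=> Finf d3; have d0 : (0 < d)%N by apply: leq_trans d3.
have [k] := ubnP #|cover C|; elim: k C => // k IH C ltC minC.
have [cycC C0 _] := minC; have [uC _] := cycC; have [f fC] := set0Pn _ C0.
have /card_gt0P[u uf] : (0 < #|f|)%N by rewrite uC.
have /card_gt0P[v] : (0 < #|f :\ u|)%N.
  by move: d3; rewrite -(uC f fC) (cardsD1 u f) uf; case: #|_|.
rewrite !inE eq_sym => /andP[uv vf].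
have uvC : adj C u v by apply/adjP; exists f; rewrite ?uf.
(* Nonemptiness of [D] provides the facet at which a placement is pinned to show that rigidity is
   open. *)
pose P D := [/\ is_cycle d D, D != set0, forall x y, adj D x y -> adj C x y
  & exists a, @rigid_placement F T d D a].
have [||D [] //|Ds PDs CE] := @fogelsanger_decomposition T d u v uv P C cycC d0.
- move=> Z ZC minZ; have [cycZ Z0 _] := minZ.
  have rigL : exists a, @rigid_placement F T d (lift_cycle d u v C Z) a.
    apply: lift_rigid => //; apply: IH => //.
    by apply: leq_trans (proper_card (push_cover ZC uvC)) _; rewrite -ltnS.
  split=> //; first exact: cycle_lift.
    have [s sZ] := set0Pn _ Z0; have [s' s'L _] := facet_lift d ZC sZ.
    by apply/set0Pn; exists s'.
  by move=> x y; apply: lift_cycle_adj.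
- move=> g; rewrite inE => /and4P[gC ug vg sgC].
  have cS : #|v |: g| = d.+1 by rewrite cardsU1 vg uC.
  split; first exact: cycle_simplex_boundary.
  + by apply/set0Pn; exists g; rewrite inE subsetUr uC /=.
  + have uvg x : x \in g -> adj C v x.
      move=> xg; have [->|xu] := eqVneq x u; first by rewrite adjC.
      apply/adjP; exists (swap u v g) => //; rewrite swap_v ug swap_x //.
      by apply: contraNneq vg => <-.
    move=> x y /adjP[h]; rewrite inE => /andP[/subsetP hS _] /andP[/hS + /hS].
    rewrite !inE => /predU1P[->|xg] /predU1P[->|yg].
    * by apply/adjP; exists f; rewrite ?vf.
    * exact: uvg.
    * by rewrite adjC; apply: uvg.
    * by apply/adjP; exists g; rewrite ?xg.
  + have [_ [a gp]] := @line_open_general_position F T d Finf.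
    by exists a; split=> //; apply: simplex_rigid => //; apply: ltnW.
(* The pieces may be rigid at different placements; openness yields a common one. *)
have [|_ [a Ha]] := @line_open_all F T d _ Ds (fun D a => rigid_placement D a) Finf.
  move=> D /PDs[cycD D0 _ eD]; split=> //; have [uD _] := cycD.
  have [s sD] := set0Pn _ D0.
  have [z zs] := cycle_facet_complement cycD D0 d0 (uD s sD).
  exact: line_open_rigid Finf sD (uD s sD) zs.
have gp : general_position a.
  have : f \in chain_sum Ds by rewrite -CE.
  rewrite inE; case: (Ds) Ha => [//|D ? Ha] _.
  by have [] := Ha D (mem_head _ _).
exists a; split=> //; apply: (rigid_chain_sum d0 gp minC CE) => D DDs.
by have [cycD _ DC _] := PDs D DDs; have [_ rig] := Ha D DDs.
Qed.
End Fogelsanger.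

(** * The cone over the boundary *)

Section Cone.
Variables (n d : nat) (Delta : {set {set 'I_n}}).
Hypothesis d3 : (3 <= d)%N.
Hypothesis Delta_npm : normal_pseudomanifold_with_boundary d Delta.
Local Notation T := (option 'I_n).
Implicit Types (A G Q R f h r : {set 'I_n}) (Z : {set {set T}}).

(* [up true f] is the join of [f] with the apex [None]. *)
Definition up (b : bool) f : {set T} :=
  [set x | if x is Some i then i \in f else b].

Definition down (g : {set T}) : {set 'I_n} := [set i | Some i \in g].

Lemma downK (g : {set T}) : up (None \in g) (down g) = g.
Proof. by apply/setP => -[i|]; rewrite !inE. Qed.

Lemma upK b f : down (up b f) = f.
Proof. by apply/setP => i; rewrite !inE. Qed.

Lemma None_up b f : (None \in up b f) = b.
Proof. by rewrite inE. Qed.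

Lemma Some_up b f i : (Some i \in up b f) = (i \in f).
Proof. by rewrite inE. Qed.

Lemma up_subset b c f g : (up b f \subset up c g) = (b ==> c) && (f \subset g).
Proof.
apply/subsetP/andP => [fg|[bc /subsetP fg] [i|]]; last 2 first.
- by rewrite !Some_up => /fg.
- by rewrite !None_up; apply/implyP.
split; first by apply/implyP; have := fg None; rewrite !None_up.
by apply/subsetP => i; have := fg (Some i); rewrite !Some_up.
Qed.

Lemma card_up b f : #|up b f| = (b + #|f|)%N.
Proof.
have -> : up b f = (if b then [set None] else set0) :|: [set Some i | i in f].
  apply/setP => -[i|]; rewrite inE in_setU.
    rewrite mem_imset; last exact: Some_inj.
    by case: (b); rewrite !inE.
  have /negPf-> : None \notin [set Some i | i in f] by apply/imsetP => -[].
  by case: (b); rewrite !inE.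
rewrite cardsU disjoint_setI0 ?cards0 ?subn0; last first.
  case: b; last by rewrite -setI_eq0 set0I.
  by rewrite disjoints1; apply/imsetP => -[].
by rewrite card_imset; [case: b; rewrite ?cards1 ?cards0 | exact: Some_inj].
Qed.

Lemma big_up (P : pred {set T}) : \big[addb/false]_(g : {set T}) P g =
  \big[addb/false]_f P (up false f) (+) \big[addb/false]_f P (up true f).
Proof.
rewrite (reindex (fun p : bool * {set 'I_n} => up p.1 p.2)) /=; last first.
  exists (fun g : {set T} => (None \in g, down g)) => [[b f] _|g _] /=.
    by rewrite None_up upK.
  exact: downK.
rewrite -(pair_bigA _ (fun b f => P (up b f))) /= big_bool /=.
by rewrite addbC.
Qed.

Let npm : normal_pseudomanifold d Delta := proj1 Delta_npm.

Lemma face_sub A G : A \in Delta -> G \subset A -> G \in Delta.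
Proof. by case: (npm_complex npm) => _; apply. Qed.

Lemma facetsE f : (f \in facets Delta) = (f \in Delta) && (#|f| == d).
Proof.
apply/idP/andP => [fD|[fD /eqP cf]].
  by split; [move: fD; rewrite inE => /maxsetp | rewrite (npm_pure npm)].
have [g maxg fg] := maxset_exists (P := fun B => B \in Delta) fD.
have gF : g \in facets Delta by rewrite inE.
suff -> : f = g by [].
by apply/eqP; rewrite eqEcard fg cf (npm_pure npm gF) leqnn.
Qed.

Lemma face_facet G : G \in Delta -> exists2 f, f \in facets Delta & G \subset f.
Proof.
move=> GD; have [g maxg Gg] := maxset_exists (P := fun B => B \in Delta) GD.
by exists g; rewrite ?inE.
Qed.

Lemma uniform_facets : uniform d (facets Delta).
Proof. by move=> f; rewrite facetsE => /andP[_ /eqP]. Qed.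

(** A ridge lies in at most two facets, so exactly one means an odd number: the boundary ridges form
    the boundary modulo 2 of the facets. *)
Lemma boundary_ridgesE R :
  (R \in boundary_ridges d Delta) = (#|R|.+1 == d) && bd (facets Delta) R.
Proof.
have d0 : (0 < d)%N by apply: leq_trans d3.
rewrite inE bdE -[[set f in _ | _]]/(facets_above Delta R).
have -> : (#|R| == d.-1) = (#|R|.+1 == d) by rewrite -[d in RHS]prednK.
have [cR|] := eqVneq #|R|.+1 d; last by rewrite andbF.
rewrite /=; have [RD|RD] /= := boolP (R \in Delta).
  have := npm_ridge npm RD; rewrite -cR => /(_ erefl).
  by case: #|_| => [|[|[|]]].
suff -> : facets_above Delta R = set0 by rewrite cards0.
apply/setP => f; rewrite !inE; apply/negP => /andP[/maxsetp fD Rf].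
by case/negP: RD; apply: face_sub Rf.
Qed.

Definition cone : {set {set T}} :=
  [set g : {set T} | if None \in g then down g \in boundary_ridges d Delta
           else down g \in facets Delta].

Lemma in_cone b f : (up b f \in cone) =
  if b then f \in boundary_ridges d Delta else f \in facets Delta.
Proof. by rewrite inE None_up upK. Qed.

Lemma uniform_cone : uniform d cone.
Proof.
move=> g; rewrite -(downK g) in_cone card_up.
case: (None \in g) => [|/uniform_facets //].
by rewrite boundary_ridgesE => /andP[/eqP <-].
Qed.

Lemma bd_up_false Z Q : uniform d Z -> #|Q|.+1 = d ->
  bd Z (up false Q) =
  \big[addb/false]_f ((up false f \in Z) && (Q \subset f)) (+) (up true Q \in Z).
Proof.
move=> uZ cQ; rewrite /bd big_up; congr (_ (+) _).
  by apply: eq_bigr => f _; rewrite up_subset.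
rewrite (bigD1 Q) //= up_subset subxx /= andbT big1 ?addbF // => r rQ.
rewrite up_subset /=; apply: contraNF rQ => /andP[rZ Qr].
rewrite eq_sym eqEcard Qr /=; have := uZ _ rZ; rewrite card_up add1n -cQ => -[->].
exact: leqnn.
Qed.

(** Over a ridge through the apex one meets a boundary of a boundary; over any other, the cone facet
    restores parity. *)
Lemma cycle_cone : is_cycle d cone.
Proof.
split=> [|R]; first exact: uniform_cone.
rewrite -(downK R) card_up; case: (None \in R); set Q := down R => cQ.
  have -> : bd cone (up true Q) =
      \big[addb/false]_r ((r \in boundary_ridges d Delta) && (Q \subset r)).
    rewrite /bd big_up big1 ?addFb => [|f _]; last by rewrite up_subset andbF.
    by apply: eq_bigr => r _; rewrite in_cone up_subset.
  apply/negbT; rewrite -[RHS](bd_one_step (Q := Q) uniform_facets) //.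
  rewrite big_cofaces; apply: eq_bigr => r _; rewrite boundary_ridgesE -cQ.
  by rewrite add1n eqSS andbC andbA.
rewrite bd_up_false //; last exact: uniform_cone.
rewrite in_cone boundary_ridgesE cQ eqxx /= addbC.
rewrite (_ : \big[addb/false]_f _ = bd (facets Delta) Q) ?addbb //.
by apply: eq_bigr => f _; rewrite in_cone.
Qed.

Lemma link_set0 : link Delta set0 = Delta.
Proof.
apply/setP => H; rewrite inE setU0; case: (H \in Delta) => //=.
by rewrite -setI_eq0 setI0 eqxx.
Qed.

Section Subcycle.
Variable Z : {set {set T}}.
Hypothesis (ZC : Z \subset cone) (cycZ : is_cycle d Z).

(** Two distinct facets exhaust those on [G], so no cone facet lies over [G], and evenness makes [Z]
    take both or neither. *)
Lemma subcycle_ridge G f (g : {set 'I_n}) : #|G|.+1 = d -> f \in facets Delta ->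
  g \in facets Delta -> G \subset f -> G \subset g ->
  (up false f \in Z) = (up false g \in Z).
Proof.
move=> cG fF gF Gf Gg; have [->//|fg] := eqVneq f g.
have fD : f \in Delta by move: fF; rewrite facetsE => /andP[].
have aboveE : facets_above Delta G = [set f; g].
  apply/esym/eqP; rewrite eqEcard cards2 fg.
  rewrite (npm_ridge npm (face_sub fD Gf)) -?cG // andbT.
  by apply/subsetP => h; rewrite in_set2 [_ \in facets_above _ _]in_set =>
    /orP[]/eqP->; apply/andP.
have [uZ cZ] := cycZ; have := cZ (up false G).
rewrite card_up cG => /(_ erefl); rewrite bd_up_false //.
have -> : (up true G \in Z) = false.
  apply: contraTF isT => /(subsetP ZC); rewrite in_cone boundary_ridgesE bdE.
  by rewrite -[[set h in _ | _]]/(facets_above Delta G) aboveE cards2 fg andbF.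
rewrite addbF (bigD1 f) //= (bigD1 g) 1?eq_sym //= Gf Gg !andbT big1 ?addbF.
  by case: (up false f \in Z); case: (up false g \in Z).
move=> h /andP[hf hg]; apply: contraNF hf => /andP[/(subsetP ZC)].
rewrite in_cone => hF Gh; have : h \in facets_above Delta G by rewrite inE hF.
by rewrite aboveE !inE (negPf hg) orbF.
Qed.

(** Induction on the codimension [k] of [G]. A path in the link of [G] joins a vertex of [f] to one
    of [g]; consecutive path vertices share a facet with [G], and facets sharing a path vertex are
    compared by induction on a larger face. *)
Lemma subcycle_star k G f (g : {set 'I_n}) : G \in Delta -> (#|G| + k)%N = d ->
  f \in facets Delta -> g \in facets Delta -> G \subset f -> G \subset g ->
  (up false f \in Z) = (up false g \in Z).
Proof.
elim: k G f g => [|k IH] G f g GD cG fF gF Gf Gg.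
  have fG h : h \in facets Delta -> G \subset h -> h = G.
    move=> /uniform_facets ch Gh; apply/esym/eqP.
    by rewrite eqEcard Gh ch -cG addn0 leqnn.
  by rewrite (fG f) // (fG g).
case: k IH cG => [_|k IH cG]; first by rewrite addn1 => cG; apply: (subcycle_ridge cG).
have outside h : h \in facets Delta -> G \subset h -> exists2 x, x \in h & x \notin G.
  move=> /uniform_facets ch Gh; apply/subsetPn; apply/negP => /subset_leq_card.
  by rewrite ch -cG addnS ltnNge leq_addr.
have linkP x h : h \in facets Delta -> G \subset h -> x \in h -> x \notin G ->
    [set x] \in link Delta G.
  rewrite facetsE => /andP[hD _] Gh xh xG; rewrite inE disjoints1 xG andbT.
  by apply: face_sub hD _; rewrite subUset sub1set xh.
have conn : connected_complex (link Delta G).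
  have [->|G0] := eqVneq G set0; first by rewrite link_set0; exact: (npm_connected npm).
  by apply: (npm_link npm GD G0); rewrite -cG leq_add2l.
have [x xf xG] := outside f fF Gf; have [y yg yG] := outside g gF Gg.
have star z f' g' : z \notin G -> f' \in facets Delta -> g' \in facets Delta ->
    G \subset f' -> G \subset g' -> z \in f' -> z \in g' ->
    (up false f' \in Z) = (up false g' \in Z).
  move=> zG f'F g'F Gf' Gg' zf' zg'; apply: (IH (z |: G)) => //.
  - move: f'F; rewrite facetsE => /andP[fD _].
    by apply: face_sub fD _; rewrite subUset sub1set zf'.
  - by rewrite cardsU1 zG add1n addSnnS.
  - by rewrite subUset sub1set zf'.
  - by rewrite subUset sub1set zg'.
case/connectP: (conn x y (linkP x f fF Gf xf xG) (linkP y g gF Gg yg yG)) => p.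
elim: p x f fF Gf xf xG => [|z p IHp] x f fF Gf xf xG /=.
  by move=> _ yx; apply: (star x) => //; rewrite -yx.
case/andP=> xz pz yE; move: xz; rewrite inE -setI_eq0 => /andP[xzG dis].
have zG : z \notin G.
  apply/negP => zG; move/eqP/setP/(_ z): dis.
  by rewrite !inE eqxx orbT zG.
have [h hF xzh] := face_facet xzG.
move: xzh; rewrite !subUset !sub1set => /andP[/andP[xh zh] Gh].
rewrite (star x f h) //; exact: IHp hF Gh zh zG pz yE.
Qed.
End Subcycle.

(** A subcycle contains all facets of [Delta] or none; parity at the boundary ridges then forces all
    cone facets or none. *)
Lemma minimal_cycle_cone : minimal_cycle d cone.
Proof.
have [r0 r0B] := set0Pn _ (proj2 Delta_npm).
split; first exact: cycle_cone.
  by apply/set0Pn; exists (up true r0); rewrite in_cone.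
move=> Z ZC cycZ Z0; have [uZ cZ] := cycZ.
have [s0D _] := npm_complex npm.
have const f (g : {set 'I_n}) : f \in facets Delta -> g \in facets Delta ->
    (up false f \in Z) = (up false g \in Z).
  move=> fF gF; apply: (subcycle_star ZC cycZ (k := d) s0D) => //; rewrite ?sub0set //.
  by rewrite cards0.
have ridge r : r \in boundary_ridges d Delta ->
    \big[addb/false]_f ((up false f \in Z) && (r \subset f)) = (up true r \in Z).
  rewrite boundary_ridgesE => /andP[/eqP cr _].
  have := cZ (up false r); rewrite card_up cr bd_up_false // => /(_ erefl).
  by case: (\big[_/_]_f _); case: (_ \in _).
have [f0 f0F _] := face_facet s0D.
apply/eqP; rewrite eqEsubset ZC; apply/subsetP => g.
have [f0Z|f0Z] := boolP (up false f0 \in Z).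
  have facetZ f : (up false f \in Z) = (f \in facets Delta).
    apply/idP/idP => [/(subsetP ZC)|fF]; first by rewrite in_cone.
    by rewrite (const f f0).
  rewrite -(downK g) in_cone; case: (None \in g) => gC; last by rewrite facetZ.
  rewrite -ridge //; move: gC; rewrite boundary_ridgesE => /andP[_].
  by rewrite /bd; under eq_bigr do rewrite -facetZ.
have [g' g'Z] := set0Pn _ Z0; have := subsetP ZC _ g'Z.
move: g'Z; rewrite -(downK g') in_cone; case: (None \in g') => g'Z g'C.
  have := ridge _ g'C; rewrite g'Z big1 // => f _.
  apply: contraNF f0Z => /andP[fZ _]; rewrite (const f0 f) //.
  by have := subsetP ZC _ fZ; rewrite in_cone.
by move: f0Z; rewrite (const _ _ f0F g'C) g'Z.
Qed.

Lemma pinned_boundary_rigidity (F : fieldType) : infinite_type F ->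
    full_vertex_set Delta ->
  exists a : 'I_n -> 'rV[F]_d.+1, forall c : 'I_n -> 'rV[F]_d.+1,
    (forall v, [set v] \in boundary d Delta -> c v = 0) ->
    (forall v, dot (a v) (c v) = 0) ->
    (forall x y, [set x; y] \in Delta -> dot (a x) (c y) + dot (a y) (c x) = 0) ->
  forall v, c v = 0.
Proof.
move=> Finf full; have [a [gp rig]] := minimal_cycle_rigid Finf d3 minimal_cycle_cone.
exists (fun v => a (Some v)) => c cB dg ed v.
(* The equations at the apex hold trivially: its neighbours are boundary vertices, where the
   velocity is zero too. *)
pose c' (x : T) := if x is Some i then c i else 0.
have [x y|A altA EA] := rig c'.
  case/adjP => g + /andP[].
  have c0 i g' : g' \in boundary_ridges d Delta -> i \in g' -> c i = 0.
    move=> g'B ig; apply: cB; rewrite inE; apply/exists_inP; exists g' => //.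
    by rewrite sub1set.
  case: x y => [x|] [y|] gC xg yg; rewrite /= ?dot0r ?add0r ?addr0 //.
  - split=> [[->] //|]; have := gC; rewrite -(downK g) in_cone.
    case: (None \in g) => [gB|].
      by rewrite (c0 x (down g)) ?(c0 y (down g)) ?dot0r ?addr0 // in_set.
    rewrite facetsE => /andP[gD _]; apply: ed; apply: face_sub gD _.
    by rewrite subUset !sub1set !inE xg.
  - split=> //; move: gC; rewrite -{1}(downK g) yg in_cone => gB.
    by rewrite (c0 _ (down g)) ?dot0r // in_set.
  - split=> //; move: gC; rewrite -{1}(downK g) xg in_cone => gB.
    by rewrite (c0 _ (down g)) ?dot0r // in_set.
have [r0 r0B] := set0Pn _ (proj2 Delta_npm).
have uC : up true r0 \in cone by rewrite in_cone.
have cone0 : cone != set0 by apply/set0Pn; exists (up true r0).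
have d0 : (0 < d)%N by apply: leq_trans d3.
have [z zr] := cycle_facet_complement cycle_cone cone0 d0 (uniform_cone uC).
have A0 : A = 0.
  apply: (alternating_eq0 gp (uniform_cone uC) zr altA) => x xr.
  rewrite -EA; last by apply/bigcupP; exists (up true r0).
  case: x xr => [x|//]; rewrite Some_up /= => xr.
  apply: cB; rewrite inE; apply/exists_inP; exists r0 => //.
  by rewrite sub1set.
have [f fF vf] := face_facet (full v).
have := EA (Some v); rewrite A0 mulmx0 /=; apply.
by apply/bigcupP; exists (up false f); rewrite ?in_cone // Some_up -sub1set.
Qed.
End Cone.

(** * The linear strand of a graded free resolution *)

Section ShiftedHomogeneity.
Variables (R : idomainType) (n : nat).
Local Notation S := {mpoly R[n]}.
Implicit Types f g : S.

(* [f] is homogeneous of degree [j] as a coefficient of a basis vector of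
   degree [e]. *)
Definition shifted_homog (e j : nat) f :=
  forall m, m \in msupp f -> (mdeg m + e = j)%N.

Lemma shifted_homogE e j f :
  shifted_homog e j f <-> forall m, (mdeg m + e)%N != j -> f@_m = 0.
Proof.
split=> H m; first by move=> ne; apply: memN_msupp_eq0; apply: contraNN ne => /H/eqP.
by rewrite mcoeff_msupp; apply: contraNeq => /H->.
Qed.

Lemma shifted_homog0 e j : shifted_homog e j 0.
Proof. by move=> m; rewrite msupp0. Qed.

Lemma shifted_homogD e j f g :
  shifted_homog e j f -> shifted_homog e j g -> shifted_homog e j (f + g).
Proof.
move=> /shifted_homogE hf /shifted_homogE hg; apply/shifted_homogE => m ne.
by rewrite mcoeffD hf // hg // addr0.
Qed.

Lemma shifted_homogN e j f : shifted_homog e j f -> shifted_homog e j (- f).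
Proof. by move=> hf m; rewrite (perm_mem (msuppN f)); apply: hf. Qed.

Lemma shifted_homogM k e j f g :
  shifted_homog k j f -> shifted_homog e k g -> shifted_homog e j (f * g).
Proof.
move=> hf hg m /msuppM_le/allpairsP[[m1 m2] /= [/hf m1f /hg m2g ->]].
by rewrite mdegD -addnA m2g.
Qed.

Lemma shifted_homog_sum (I : Type) (r : seq I) (P : pred I) (G : I -> S) e j :
  (forall i, P i -> shifted_homog e j (G i)) ->
  shifted_homog e j (\sum_(i <- r | P i) G i).
Proof.
move=> hG; elim/big_rec: _ => [|i f Pi]; first exact: shifted_homog0.
by apply: shifted_homogD; apply: hG.
Qed.

Lemma shifted_homogC e (c : R) : shifted_homog e e c%:MP.
Proof.
apply/shifted_homogE => m ne; rewrite mcoeffC.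
case: (m =P 0%MM) ne => [->|_ _]; last by rewrite mulr0.
by rewrite mdeg0 add0n eqxx.
Qed.

Lemma shifted_homogX e i : shifted_homog e e.+1 'X_i.
Proof. by move=> m; rewrite msuppX inE => /eqP->; rewrite mdeg1. Qed.

Lemma shifted_homogZ e j c f : shifted_homog e j f -> shifted_homog e j (c *: f).
Proof. by rewrite -mul_mpolyC; apply: shifted_homogM; apply: shifted_homogC. Qed.

Definition shifted_part (e j : nat) f : S :=
  \sum_(m <- msupp f | (mdeg m + e == j)%N) f@_m *: 'X_[m].

Lemma mcoeff_shifted_part e j f m :
  (shifted_part e j f)@_m = if (mdeg m + e == j)%N then f@_m else 0.
Proof.
rewrite raddf_sum /=.
under eq_bigr do rewrite mcoeffZ mcoeffX.
have [mf|mf] := boolP (m \in msupp f).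
  rewrite big_mkcond (bigD1_seq m) //= ?msupp_uniq // eqxx mulr1 big1 ?addr0 //.
  by move=> m' /negPf ->; rewrite mulr0 if_same.
rewrite big_seq_cond big1 ?(memN_msupp_eq0 mf) ?if_same // => m' /andP[m'f _].
by case: eqP => [E|_]; [rewrite -E m'f in mf | rewrite mulr0].
Qed.

Lemma shifted_part_homog e j f : shifted_homog e j (shifted_part e j f).
Proof.
by apply/shifted_homogE => m ne; rewrite mcoeff_shifted_part (negPf ne).
Qed.

Lemma shifted_partD e j f g :
  shifted_part e j (f + g) = shifted_part e j f + shifted_part e j g.
Proof.
apply/mpolyP => m; rewrite mcoeffD !mcoeff_shifted_part mcoeffD.
by case: ifP => //; rewrite addr0.
Qed.

Lemma shifted_part_id e j f : shifted_homog e j f -> shifted_part e j f = f.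
Proof.
move/shifted_homogE => hf; apply/mpolyP => m; rewrite mcoeff_shifted_part.
by case: ifP => // /negbT/hf.
Qed.

Lemma shifted_partM k e j f g : shifted_homog e k g ->
  shifted_part e j (f * g) = shifted_part k j f * g.
Proof.
move=> hg; pose f' := f - shifted_part k j f.
have f'E m : (mdeg m + k)%N = j -> f'@_m = 0.
  by move=> mj; rewrite mcoeffB mcoeff_shifted_part mj eqxx subrr.
have {1}-> : f = shifted_part k j f + f' by rewrite addrC subrK.
rewrite mulrDl shifted_partD.
rewrite (shifted_part_id (shifted_homogM (@shifted_part_homog k j f) hg)).
rewrite [X in _ + X](_ : _ = 0) ?addr0 //.
apply/mpolyP => m; rewrite mcoeff0 mcoeff_shifted_part; case: eqP => // mj.
apply: memN_msupp_eq0; apply/negP => /msuppM_le/allpairsP[[m1 m2] /= [m1f m2g mE]].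
move: m1f; rewrite mcoeff_msupp f'E ?eqxx //.
by rewrite -(hg m2 m2g) -mj mE mdegD addnA.
Qed.

Lemma shifted_part_sum (I : Type) (r : seq I) (G : I -> S) e j :
  shifted_part e j (\sum_(i <- r) G i) = \sum_(i <- r) shifted_part e j (G i).
Proof.
elim/big_rec2: _ => [|i f g _ <-]; last by rewrite shifted_partD.
by apply: shifted_part_id; apply: shifted_homog0.
Qed.

End ShiftedHomogeneity.

(** * Killing linear forms one at a time *)

Section Projections.
Variables (F : fieldType) (n : nat) (Q : 'M[F]_n).
Hypothesis Q_unit : Q \in unitmx.
Local Notation S := {mpoly F[n]}.
Implicit Types f g : S.

Definition lform (i : 'I_n) : S := \sum_j Q i j *: 'X_j.

(* [proj k] is the substitution that kills the first [k] of the linear forms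
   [lform i] and fixes the others; its kernel is the ideal they generate. *)
Definition proj_var (k : nat) (j : 'I_n) : S :=
  \sum_(i : 'I_n | (k <= i)%N) invmx Q j i *: lform i.

Definition proj (k : nat) : S -> S := comp_mpoly [tuple proj_var k j | j < n].
HB.instance Definition _ k := GRing.RMorphism.on (proj k).

Lemma projX k j : proj k 'X_j = proj_var k j.
Proof. by rewrite /proj comp_mpolyXU nth_mktuple. Qed.

Lemma projZ k c f : proj k (c *: f) = c *: proj k f.
Proof. exact: comp_mpolyZ. Qed.

Lemma proj_lform k i : proj k (lform i) = if (k <= i)%N then lform i else 0.
Proof.
rewrite raddf_sum /=; under eq_bigr do rewrite projZ projX scaler_sumr.
rewrite exchange_big /=.
transitivity (\sum_(i' : 'I_n | (k <= i')%N) (1%:M : 'M[F]_n) i i' *: lform i').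
  apply: eq_bigr => i' _; rewrite -(mulmxV Q_unit) !mxE scaler_suml.
  by apply: eq_bigr => j _; rewrite scalerA.
rewrite big_mkcond (bigD1 i) //= mxE eqxx scale1r big1 ?addr0 // => i' /negPf i'i.
by rewrite mxE eq_sym i'i scale0r if_same.
Qed.

Lemma rmorph_mpoly_eq (f1 f2 : {rmorphism S -> S}) :
  (forall c, f1 c%:MP = f2 c%:MP) -> (forall i, f1 'X_i = f2 'X_i) -> f1 =1 f2.
Proof.
move=> eC eX p; rewrite [p]mpolyE !raddf_sum; apply: eq_bigr => m _.
rewrite /= -mul_mpolyC !rmorphM /= eC mpolyXE_id !rmorph_prod; congr (_ * _).
by apply: eq_bigr => i _; rewrite !rmorphXn /= eX.
Qed.

Lemma projC k c : proj k c%:MP = c%:MP.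
Proof. exact: comp_mpolyC. Qed.

Lemma proj_proj a b f : (a <= b)%N -> proj b (proj a f) = proj b f.
Proof.
move=> ab; apply: (@rmorph_mpoly_eq (proj b \o proj a) (proj b)) => [c|j] /=.
  by rewrite !projC.
rewrite !projX raddf_sum /= /proj_var.
rewrite big_mkcond [RHS]big_mkcond; apply: eq_bigr => i _.
rewrite projZ proj_lform; case: (leqP b i) => bi; first by rewrite (leq_trans ab bi).
by rewrite scaler0 if_same.
Qed.

Lemma proj0 f : proj 0 f = f.
Proof.
apply: (@rmorph_mpoly_eq (proj 0) idfun) => [c|j] /=; first exact: projC.
rewrite projX /proj_var /lform.
under eq_bigr do rewrite scaler_sumr.
rewrite exchange_big /=.
transitivity (\sum_j' (1%:M : 'M[F]_n) j j' *: ('X_j' : S)).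
  apply: eq_bigr => i' _; rewrite -(mulVmx Q_unit) !mxE scaler_suml.
  by apply: eq_bigr => j' _; rewrite scalerA.
rewrite (bigD1 j) //= mxE eqxx scale1r big1 ?addr0 // => i' /negPf i'i.
by rewrite mxE eq_sym i'i scale0r.
Qed.

(** At the last stage only constant terms remain, so the homology modulo all [n] forms is Tor. *)
Lemma proj_full f : proj n f = (f@_0%MM)%:MP.
Proof.
apply: (@rmorph_mpoly_eq (proj n) (@mpolyC n F \o mcoeff 0%MM)) => [c|j] /=.
  by rewrite projC mcoeffC eqxx mulr1.
rewrite projX /proj_var big1 => [|i]; last by rewrite leqNgt ltn_ord.
by rewrite mcoeffX mnm1_eq0 mpolyC0.
Qed.

Lemma lform_neq0 i : lform i != 0.
Proof.
apply: contraNneq (oner_neq0 F) => l0.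
have : (Q *m invmx Q) i i = 1 by rewrite mulmxV // mxE eqxx.
rewrite mxE big1 => [<- //|j _].
have := congr1 (mcoeff U_(j)%MM) l0; rewrite mcoeff0 raddf_sum /= (bigD1 j) //=.
rewrite mcoeffZ mcoeffX eqxx mulr1 big1 ?addr0 => [->|j' /negPf j'j].
  by rewrite mul0r.
by rewrite mcoeffZ mcoeffXU j'j mulr0.
Qed.

Lemma shifted_homog_lform e i : shifted_homog e e.+1 (lform i).
Proof. by apply: shifted_homog_sum => j _; apply/shifted_homogZ/shifted_homogX. Qed.

Lemma shifted_homog_proj k e j f : shifted_homog e j f -> shifted_homog e j (proj k f).
Proof.
move=> hf; rewrite [f]mpolyE raddf_sum big_seq; apply: shifted_homog_sum => m /hf <-.
rewrite /= projZ; apply: shifted_homogZ; rewrite mpolyXE_id rmorph_prod /= mdegE.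
elim/big_rec2: _ => [|i g q _ IH]; first by rewrite add0n; apply: shifted_homogC.
rewrite -addnA; apply: (shifted_homogM _ IH).
rewrite rmorphXn /= projX; elim: (m i) => [|q' IH']; first exact: shifted_homogC.
rewrite exprS; apply: shifted_homogM IH'.
apply: shifted_homog_sum => i' _; apply: shifted_homogZ.
exact: shifted_homog_lform.
Qed.

(** The property is stable under sums and products, so constants and variables suffice; for a
    variable the quotient is an entry of [invmx Q]. *)
Lemma proj_succ_diff (k : 'I_n) f : exists g, proj k f - proj k.+1 f = lform k * g.
Proof.
have clM f1 f2 : (exists g, proj k f1 - proj k.+1 f1 = lform k * g) ->
    (exists g, proj k f2 - proj k.+1 f2 = lform k * g) ->
    exists g, proj k (f1 * f2) - proj k.+1 (f1 * f2) = lform k * g.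
  move=> [g1 E1] [g2 E2]; exists (g1 * proj k f2 + proj k.+1 f1 * g2).
  by rewrite !rmorphM /= mulrDr mulrA -E1 mulrCA -E2 mulrBl mulrBr addrA subrK.
have clC c : exists g, proj k c%:MP - proj k.+1 c%:MP = lform k * g.
  by exists 0; rewrite !projC subrr mulr0.
rewrite [f]mpolyE; elim/big_rec: _ => [|m p _ [g E]].
  by exists 0; rewrite !rmorph0 subrr mulr0.
suff [g' E'] : exists g,
    proj k (f@_m *: 'X_[m]) - proj k.+1 (f@_m *: 'X_[m]) = lform k * g.
  by exists (g' + g); rewrite mulrDr -E -E' !rmorphD /= opprD addrACA.
rewrite -mul_mpolyC; apply: (clM _ _ (clC _)); rewrite mpolyXE_id.
elim/big_rec: _ => [|i q _ IHq]; first exact: clC.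
apply: (clM _ _ _ IHq); elim: (m i) => [|q' IHq']; first exact: clC.
rewrite exprS; apply: (clM _ _ _ IHq'); exists (invmx Q i k)%:MP.
rewrite !projX /proj_var (bigD1 k) //= mulrC mul_mpolyC.
rewrite [X in _ + X - _](eq_bigl (fun i0 : 'I_n => (k < i0)%N)) ?addrK // => i0.
by rewrite ltn_neqAle andbC eq_sym.
Qed.

(** The quotient by the first [k] forms embeds in the domain [S] through [proj k], so [lform k] is a
    nonzerodivisor on it. *)
Lemma proj_lform_mul0 (k : 'I_n) f : proj k (lform k * f) = 0 -> proj k f = 0.
Proof.
rewrite rmorphM /= proj_lform leqnn => /eqP.
by rewrite mulf_eq0 (negPf (lform_neq0 k)) => /eqP.
Qed.

Lemma proj_succ_eq0 (k : 'I_n) e j f : shifted_homog e j.+1 f -> proj k.+1 f = 0 ->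
  exists2 g, shifted_homog e j g & proj k (f - lform k * g) = 0.
Proof.
move=> hf f0; have [g] := proj_succ_diff k f; rewrite f0 subr0 => E.
exists (shifted_part e j g); first exact: shifted_part_homog.
have E' : proj k f = lform k * shifted_part e j g.
  rewrite -(shifted_part_id (shifted_homog_proj (k := k) hf)) E.
  rewrite [lform k * g]mulrC [RHS]mulrC.
  rewrite (shifted_partM _ _ (@shifted_homog_lform e k)); congr (_ * _).
  by apply/mpolyP => m; rewrite !mcoeff_shifted_part addnS eqSS.
rewrite rmorphB rmorphM /= proj_lform leqnn; have := congr1 (proj k) E'.
by rewrite proj_proj // rmorphM /= proj_lform leqnn => <-; rewrite subrr.
Qed.

Lemma proj_eq0_decomposition k e j f : (k <= n)%N -> shifted_homog e j.+1 f ->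
    proj k f = 0 ->
  exists2 g : 'I_n -> S, (forall s, shifted_homog e j (g s)) &
    f = \sum_(s : 'I_n | (s < k)%N) lform s * g s.
Proof.
elim: k f => [|k IH] f kn hf f0.
  exists (fun=> 0) => [s|]; first exact: shifted_homog0.
  by rewrite big1 // -f0 proj0.
have [g hg fg] := @proj_succ_eq0 (Ordinal kn) e j f hf f0.
have [|g' hg' E] := IH _ (ltnW kn) _ fg.
  apply: shifted_homogD hf _; apply: shifted_homogN.
  exact: shifted_homogM (@shifted_homog_lform j _) hg.
exists (fun s => if s == Ordinal kn then g else g' s) => [s|]; first by case: ifP.
rewrite (bigD1 (Ordinal kn)) //= eqxx -[LHS](subrK (lform (Ordinal kn) * g)) E addrC.
congr (_ + _); apply: eq_big => [s|s].
  by rewrite ltnS [LHS]ltn_neqAle andbC.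
by move=> sk; rewrite -[s == _]/(s == k :> nat) (ltn_eqF sk).
Qed.
End Projections.

(** * Homology of the resolution modulo linear forms *)

Section LinearStrand.
Variables (F : fieldType) (n : nat) (Q : 'M[F]_n).
Hypothesis Q_unit : Q \in unitmx.
Local Notation S := {mpoly F[n]}.
Variables (I J : S -> Prop) (P : graded_free_resolution I J).
Local Notation r := (res_rank P).
Local Notation diff := (res_diff P).
Local Notation lform := (lform Q).
Local Notation proj := (proj Q).
Local Notation "A ^C" := (map_mx (@mpolyC n F) A) : ring_scope.

Definition graded_rows (i j : nat) m (u : 'M[S]_(m, r i)) :=
  forall x k, shifted_homog (res_deg (g := P) k) j (u x k).

Lemma graded_rowsD i j m (u v : 'M_(m, r i)) :
  graded_rows j u -> graded_rows j v -> graded_rows j (u + v).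
Proof. by move=> hu hv x k; rewrite mxE; apply: shifted_homogD. Qed.

Lemma graded_rowsN i j m (u : 'M_(m, r i)) : graded_rows j u -> graded_rows j (- u).
Proof. by move=> hu x k; rewrite mxE; apply: shifted_homogN. Qed.

Lemma graded_rows_lform i j m (u : 'M_(m, r i)) s :
  graded_rows j u -> graded_rows j.+1 (lform s *: u).
Proof.
move=> hu x k; rewrite mxE.
exact: shifted_homogM (@shifted_homog_lform _ _ _ j _) (hu x k).
Qed.

Lemma graded_rows_diff i j m (u : 'M_(m, r i.+1)) :
  graded_rows j u -> graded_rows j (u *m diff i).
Proof.
move=> hu x k; rewrite mxE; apply: shifted_homog_sum => l _.
by apply: shifted_homogM (hu x l) _ => m'; apply: res_diff_homog.
Qed.

Lemma graded_rows_const i j m p (c : 'M[F]_(p, m)) (u : 'M_(m, r i)) :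
  graded_rows j u -> graded_rows j (c^C *m u).
Proof.
move=> hu x k; rewrite mxE; apply: shifted_homog_sum => l _.
by rewrite mxE mul_mpolyC; apply: shifted_homogZ.
Qed.

Lemma diff_diff i m (w : 'M_(m, r i.+2)) : w *m diff i.+1 *m diff i = 0.
Proof.
apply/row_matrixP => x; rewrite !row_mul row0.
by apply/res_exactS; exists (row x w).
Qed.

(** The differential is homogeneous, so the degree [j] part of any lift is again a lift. *)
Lemma graded_lift i j m (u : 'M_(m, r i)) : graded_rows j u ->
    (forall x, exists w, row x u = w *m diff i) ->
  exists2 w : 'M_(m, r i.+1), graded_rows j w & u = w *m diff i.
Proof.
move=> hu /fin_all_exists[w0 Ew0].
pose w : 'M_(m, r i.+1) := \matrix_(x, k) shifted_part (res_deg (g := P) k) j (w0 x 0 k).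
exists w => [x k|]; first by rewrite mxE; apply: shifted_part_homog.
apply/matrixP => x k; rewrite -(shifted_part_id (hu x k)).
move/rowP/(_ k): (Ew0 x); rewrite !mxE => ->; rewrite shifted_part_sum.
apply: eq_bigr => l _; rewrite mxE; apply: shifted_partM => m'.
exact: res_diff_homog.
Qed.

(** The rows of [u] form a finite family of chains; congruence modulo the first [k] forms is
    equality after [proj k]. *)
Definition cycle_mod (k i : nat) m : 'M[S]_(m, r i) -> Prop :=
  match i with
  | 0 => fun _ => True
  | i'.+1 => fun u => map_mx (proj k) (u *m diff i') = 0
  end.

Definition boundary_mod (k i j : nat) m (u : 'M[S]_(m, r i)) :=
  exists2 w : 'M[S]_(m, r i.+1), graded_rows j w & map_mx (proj k) (u - w *m diff i) = 0.

(* The degree [i.+1] part of the [i]-th homology of P / (l_1, ..., l_k) P has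
   dimension at most [N]. *)
Definition strand_le (k i N : nat) :=
  forall m (u : 'M[S]_(m, r i)), graded_rows i.+1 u -> cycle_mod k u ->
  exists A : 'M[F]_(m, N), forall p (c : 'M[F]_(p, m)), c *m A = 0 ->
    boundary_mod k i.+1 (c^C *m u).

Lemma map_proj_const k p m q (c : 'M[F]_(p, m)) (u : 'M[S]_(m, q)) :
  map_mx (proj k) (c^C *m u) = c^C *m map_mx (proj k) u.
Proof.
rewrite map_mxM -map_mx_comp; congr (_ *m _).
by apply: eq_map_mx => x; rewrite /= projC.
Qed.

Lemma map_proj_succ k m q (u : 'M[S]_(m, q)) :
  map_mx (proj k) u = 0 -> map_mx (proj k.+1) u = 0.
Proof.
move=> u0; apply/matrixP => x y; move/matrixP/(_ x y): u0; rewrite !mxE => u0.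
by rewrite -(@proj_proj _ _ _ Q_unit k) // u0 rmorph0.
Qed.

Lemma cycle_divide (k : 'I_n) i j m (u : 'M[S]_(m, r i)) : graded_rows j.+1 u ->
    map_mx (proj k.+1) u = 0 ->
  exists2 w : 'M[S]_(m, r i), graded_rows j w & map_mx (proj k) (u - lform k *: w) = 0.
Proof.
move=> hu u0.
have H (x : 'I_m) (l : 'I_(r i)) : exists g, shifted_homog (res_deg (g := P) l) j g /\
    proj k (u x l - lform k * g) = 0.
  have [|g hg E] := @proj_succ_eq0 _ _ _ Q_unit k _ j (u x l) (hu x l).
    by move/matrixP/(_ x l): u0; rewrite !mxE.
  by exists g.
have [g Hg] : exists g : 'I_m -> 'I_(r i) -> S, forall x l,
    shifted_homog (res_deg (g := P) l) j (g x l) /\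
    proj k (u x l - lform k * g x l) = 0.
  have /fin_all_exists : forall x, exists g : 'I_(r i) -> S, forall l,
      shifted_homog (res_deg (g := P) l) j (g l) /\ proj k (u x l - lform k * g l) = 0.
    by move=> x; apply: (fin_all_exists (H x)).
  by [].
exists (\matrix_(x, l) g x l) => [x l|]; first by rewrite mxE; have [] := Hg x l.
by apply/matrixP => x l; rewrite !mxE; have [] := Hg x l.
Qed.

(* This is the long exact sequence of multiplication by [lform k]. *)
Lemma strand_le_succ (k : 'I_n) i N N' :
  strand_le k i.+1 N -> strand_le k i N' -> strand_le k.+1 i.+1 (N' + N).
Proof.
move=> HN HN' m u hu cu.
(* [w] represents the image of [u] under the connecting homomorphism. *)
have [w hw uw] := cycle_divide (graded_rows_diff hu) cu.
have cw : cycle_mod k w.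
  case: i HN HN' u hu cu w hw uw => [//|i] HN HN' u hu cu w hw uw /=.
  have : map_mx (proj k) ((u *m diff i.+1 - lform k *: w) *m diff i) = 0.
    by rewrite map_mxM uw mul0mx.
  rewrite mulmxBl diff_diff sub0r -scalemxAl map_mxN => /eqP.
  rewrite oppr_eq0 => /eqP E.
  apply/matrixP => x y; move/matrixP/(_ x y): E; rewrite !mxE.
  exact: proj_lform_mul0.
have [A' HA'] := HN' m w hw cw.
(* The rows of [K] give the combinations whose connecting image is a boundary; subtracting
   [lform k *: v] turns them into cycles modulo the first [k] forms. *)
pose K := kermx A'.
have [v hv Ev] := HA' _ K (mulmx_ker A').
pose u' := K^C *m u - lform k *: v.
have hu' : graded_rows i.+2 u'.
  apply: graded_rowsD; first exact: graded_rows_const.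
  by apply/graded_rowsN/graded_rows_lform.
have cu' : cycle_mod k u'.
  rewrite /= /u' mulmxBl -mulmxA -scalemxAl.
  have -> : K^C *m (u *m diff i) - lform k *: (v *m diff i) =
      K^C *m (u *m diff i - lform k *: w) + lform k *: (K^C *m w - v *m diff i).
    by rewrite mulmxBr scalerBr -scalemxAr addrA subrK.
  by rewrite map_mxD map_proj_const uw mulmx0 map_mxZ Ev scaler0 addr0.
have [A'' HA''] := HN _ u' hu' cu'.
(* A row killed by [A'] lies in the row space of [K], where [pinvmx K] gives its coordinates; [A'']
   tests those. *)
exists (row_mx A' (pinvmx K *m A'')) => p c.
rewrite mul_mx_row -row_mx0 => /eq_row_mx[cA' cA''].
have cK : (c <= K)%MS by apply/sub_kermxP.
pose e := c *m pinvmx K.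
have [|w' hw' Ew'] := HA'' p e; first by rewrite /e -mulmxA.
exists w' => //.
have -> : c^C *m u - w' *m diff i.+1 =
    (e^C *m u' - w' *m diff i.+1) + lform k *: (e^C *m v).
  rewrite /u' mulmxBr mulmxA -map_mxM /e mulmxKpV // -scalemxAr.
  by rewrite addrAC subrK.
rewrite map_mxD (map_proj_succ Ew') add0r map_mxZ /= proj_lform // ltnn.
by rewrite scale0r.
Qed.

Lemma map_proj0 m q (u : 'M[S]_(m, q)) : map_mx (proj 0) u = u.
Proof. by apply: map_mx_id => x; apply: proj0. Qed.

Lemma strand_le_exact i : strand_le 0 i.+1 0.
Proof.
move=> m u hu /=; rewrite map_proj0 => cu; exists 0 => p c _.
have [x|w hw Ew] := graded_lift hu.
  by apply/res_exactS; rewrite -row_mul cu row0.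
exists (c^C *m w); first exact: graded_rows_const.
by rewrite Ew mulmxA subrr map_mx0.
Qed.

Lemma strand_le_quotient k N : strand_le 0 0 N -> strand_le k 0 N.
Proof.
move=> HN m u hu _; have [A HA] := HN m u hu Logic.I.
exists A => p c cA; have [w hw] := HA p c cA; rewrite map_proj0 => E.
by exists w => //; rewrite E map_mx0.
Qed.

(* Injectivity of the first [k] forms on degree one kills the first strand. *)
Lemma strand_le_regular k : (k <= n)%N ->
    (forall p : 'I_n -> S, (forall s, I (p s)) -> (forall s, shifted_homog 0 1 (p s)) ->
      J (\sum_(s : 'I_n | (s < k)%N) lform s * p s) ->
      forall s : 'I_n, (s < k)%N -> J (p s)) ->
    (forall (g : 'I_(r 0) -> S), I (\sum_l g l * res_aug (g := P) l)) ->
  strand_le k 1 0.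
Proof.
move=> kn reg Isum m u hu cu; exists 0 => p c _.
suff [w hw Ew] : boundary_mod k 2 u.
  exists (c^C *m w); first exact: graded_rows_const.
  by rewrite -mulmxA -mulmxBr map_proj_const Ew mulmx0.
have hud : graded_rows 2 (u *m diff 0) by apply: graded_rows_diff.
have [w Hw] : exists w : 'I_m -> 'I_(r 0) -> 'I_n -> S, forall x l,
    (forall s, shifted_homog (res_deg (g := P) l) 1 (w x l s)) /\
    (u *m diff 0) x l = \sum_(s : 'I_n | (s < k)%N) lform s * w x l s.
  have H x l : exists g : 'I_n -> S,
      (forall s, shifted_homog (res_deg (g := P) l) 1 (g s)) /\
      (u *m diff 0) x l = \sum_(s : 'I_n | (s < k)%N) lform s * g s.
    have [|g hg E] := proj_eq0_decomposition Q_unit kn (hud x l).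
      by move/matrixP/(_ x l): cu; rewrite mxE [RHS]mxE.
    by exists g.
  have /fin_all_exists : forall x, exists w : 'I_(r 0) -> 'I_n -> S, forall l,
    (forall s, shifted_homog (res_deg (g := P) l) 1 (w l s)) /\
    (u *m diff 0) x l = \sum_(s : 'I_n | (s < k)%N) lform s * w l s.
    by move=> x; apply: (fin_all_exists (H x)).
  by [].
pose W (s : 'I_n) : 'M[S]_(m, r 0) := \matrix_(x, l) w x l s.
have hW s : graded_rows 1 (W s) by move=> x l; rewrite mxE; have [] := Hw x l.
have EW : u *m diff 0 = \sum_(s : 'I_n | (s < k)%N) lform s *: W s.
  apply/matrixP => x l; have [_ ->] := Hw x l; rewrite summxE.
  by apply: eq_bigr => s _; rewrite !mxE.
(* The augmentations [m_s] of the [W s] have degree one and satisfy [sum_s l_s m_s = 0], so by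
   assumption they vanish in [I / J], and [W s] lifts. *)
have lifts (s : 'I_n) : exists v : 'M_(m, r 1), graded_rows 1 v /\
    ((s < k)%N -> W s = v *m diff 0).
  have [sk|sk] := boolP (s < k)%N; last first.
    by exists 0; split=> // x l; rewrite mxE; apply: shifted_homog0.
  have [x|v hv Ev] := graded_lift (hW s); last by exists v.
  apply/res_exact0.
  apply: (reg (fun s => \sum_l row x (W s) 0 l * res_aug l)) sk => [s'|s'|].
  - exact: Isum.
  - apply: shifted_homog_sum => l _; apply: shifted_homogM (_ : shifted_homog _ _ _) _.
      by rewrite mxE; apply: hW.
    move=> m' /(dhomog_mf (res_aug_homog l)) <-; exact: addn0.
  have <- : \sum_l row x (u *m diff 0) 0 l * res_aug l =
      \sum_(s0 : 'I_n | (s0 < k)%N) lform s0 * (\sum_l row x (W s0) 0 l * res_aug l).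
    under [RHS]eq_bigr do rewrite big_distrr.
    rewrite [RHS]exchange_big; apply: eq_bigr => l _ /=.
    rewrite EW [row _ _ _ _]mxE summxE big_distrl; apply: eq_bigr => s0 _.
    by rewrite !mxE /= mulrA.
  by apply/res_exact0; exists (row x u); rewrite row_mul.
have [v Hv] := fin_all_exists lifts.
(* A correction by killed forms turns [u] into a cycle over [S], hence a boundary. *)
pose u0 := u - \sum_(s : 'I_n | (s < k)%N) lform s *: v s.
have hu0 : graded_rows 2 u0.
  apply: graded_rowsD hu _; apply: graded_rowsN => x l; rewrite summxE.
  apply: shifted_homog_sum => s _; apply: graded_rows_lform.
  by have [] := Hv s.
have [x|w' hw' Ew'] := graded_lift hu0.
  apply/res_exactS; rewrite -row_mul (_ : u0 *m diff 0 = 0) ?row0 //.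
  rewrite mulmxBl EW mulmx_suml; apply/eqP; rewrite subr_eq0; apply/eqP.
  by apply: eq_bigr => s sk; rewrite -scalemxAl; have [_ ->] := Hv s.
exists w' => //; rewrite -Ew' /u0 opprB addrC subrK raddf_sum big1 // => s sk.
by rewrite /= map_mxZ /= proj_lform // leqNgt sk scale0r.
Qed.

(** Induction on [i], then on [k'] from exactness at [k' = 0]: both terms of the long exact sequence
    vanish. *)
Lemma strand_le_vanish k : (k <= n)%N ->
    (forall k', (k' <= k)%N -> strand_le k' 1 0) ->
  forall i k', (k' <= k)%N -> strand_le k' i.+1 0.
Proof.
move=> kn H; elim=> [|i IH] k' k'k; first exact: H.
elim: k' k'k => [|k' IHk'] k'k; first exact: strand_le_exact.
have k'n : (k' < n)%N by apply: leq_trans k'k kn.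
exact: (@strand_le_succ (Ordinal k'n) i.+1 0 0 (IHk' (ltnW k'k)) (IH k' (ltnW k'k))).
Qed.

Lemma strand_le_pascal k N : (forall i, strand_le k i.+1 0) ->
    (forall k', strand_le k' 0 N) ->
  forall m i, (k + m <= n)%N -> strand_le (k + m) i (N * 'C(m, i)).
Proof.
move=> H0 HN; elim=> [|m IH] i kmn.
  by case: i => [|i]; rewrite addn0 ?bin0 ?muln1 // bin0n muln0; apply: H0.
case: i => [|i]; first by rewrite bin0 muln1.
rewrite addnS in kmn *; rewrite binS mulnDr [(N * _ + _)%N]addnC.
exact: (@strand_le_succ (Ordinal kmn) i _ _ (IH i.+1 (ltnW kmn)) (IH i (ltnW kmn))).
Qed.

Lemma betti_le i N : strand_le n i N -> (betti P i i.+1 <= N)%N.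
Proof.
move=> H; pose Z := row_base (tor_cycles P i i.+1).
have ZT : (Z <= tor_component P i i.+1)%MS.
  rewrite eq_row_base; case: (i) => [|i'] //=; exact: capmxSl.
have Zdeg x k : Z x k != 0 -> res_deg (g := P) k = i.+1.
  case/submxP: ZT => D ->; rewrite /tor_component mul_mx_diag !mxE.
  by have [//|_] := eqVneq (res_deg k) i.+1; rewrite mulr0 eqxx.
have hZ : graded_rows i.+1 (Z^C).
  move=> x k; rewrite mxE; have [->|/Zdeg ->] := eqVneq (Z x k) 0.
    by rewrite mpolyC0; apply: shifted_homog0.
  exact: shifted_homogC.
have cZ : cycle_mod n Z^C.
  have : (Z <= tor_cycles P i i.+1)%MS by rewrite eq_row_base.
  case: (i) Z {ZT Zdeg hZ} => [//|i'] Z /= /submx_trans/(_ (capmxSr _ _))/sub_kermxP Zd.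
  apply/matrixP => x y; rewrite [LHS]mxE proj_full // [RHS]mxE.
  rewrite (_ : mcoeff 0%MM _ = 0) ?mpolyC0 //.
  transitivity ((Z *m tor_diff P i') x y); last by rewrite Zd mxE.
  rewrite !mxE raddf_sum /=; apply: eq_bigr => l _.
  by rewrite !mxE mcoeffCM.
have [A HA] := H _ _ hZ cZ.
(* The rank of [K] is at least that of the cycles minus [N], and multiplication by the row-free [Z]
   embeds [K] in the boundaries. *)
pose K := row_base (kermx A).
have KA : K *m A = 0 by apply/sub_kermxP; rewrite eq_row_base.
have [w hw Ew] := HA _ K KA.
have KZ : (K *m Z <= tor_boundaries P i i.+1)%MS.
  pose w0 := map_mx (mcoeff 0%MM) w.
  have Ew0 : K *m Z = w0 *m tor_diff P i.
    apply/matrixP => x y; move/matrixP/(_ x y): Ew.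
    rewrite [LHS]mxE [RHS]mxE proj_full // => /(congr1 (mcoeff 0%MM)).
    rewrite mcoeff0 mcoeffC eqxx mulr1 !mxE raddfB /= !raddf_sum /= sumrN => /eqP.
    rewrite subr_eq0 => /eqP E; transitivity (\sum_j ((K^C) x j * (Z^C) j y)@_0%MM).
      by apply: eq_bigr => j _; rewrite !mxE mcoeffCM mcoeffC eqxx mulr1.
    by rewrite E; apply: eq_bigr => j _; rewrite !mxE rmorphM.
  rewrite Ew0 /tor_boundaries; apply: submxMr; apply/submxP; exists w0.
  rewrite /tor_component mul_mx_diag; apply/matrixP => x y; rewrite !mxE.
  have [_|ne] /= := eqVneq (res_deg y) i.+1; first by rewrite mulr1.
  rewrite mulr0; apply: memN_msupp_eq0; apply/negP => /(hw x y).
  by rewrite mdeg0 add0n => /eqP; rewrite (negPf ne).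
have := mxrankS KZ; rewrite mxrankMfree; last exact: row_base_free.
rewrite /K eq_row_base mxrank_ker /betti => le_rank.
by rewrite leq_subCl; apply: leq_trans le_rank; rewrite leq_sub2l // rank_leq_col.
Qed.
End LinearStrand.

(** * Stanley-Reisner ideals *)

Section StanleyReisner.
Variables (F : fieldType) (n : nat).
Local Notation S := {mpoly F[n]}.

Definition msupport (m : 'X_{1..n}) : {set 'I_n} := [set i | m i != 0%N].

Lemma ideal_generated_comb (gens : S -> Prop) N (g h : 'I_N -> S) :
  (forall l, ideal_generated gens (h l)) -> ideal_generated gens (\sum_l g l * h l).
Proof.
move=> Ih; elim/big_rec: _ => [|l p _ [s gs ->]].
  by exists [::]; rewrite ?big_nil.
have [s' gs' ->] := Ih l; exists ([seq (g l * c.1, c.2) | c <- s'] ++ s).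
  by move=> c; rewrite mem_cat => /orP[/mapP[c' /gs' gc' ->]|/gs].
rewrite big_cat big_map big_distrr /=; congr (_ + _).
by apply: eq_bigr => c _; rewrite mulrA.
Qed.

Lemma ideal_generated0 (gens : S -> Prop) : ideal_generated gens 0.
Proof. by exists [::]; rewrite ?big_nil. Qed.

Lemma prod_varsE (A : {set 'I_n}) :
  \prod_(i in A) 'X_i = 'X_[\sum_(i in A) U_(i)]%MM :> S.
Proof.
rewrite (big_morph (fun m => 'X_[m] : S) (id1 := 1) (op1 := *%R)) //.
  by move=> m1 m2; rewrite mpolyXD.
exact: mpolyX0.
Qed.

Lemma stanley_reisner_coeff (K : {set {set 'I_n}}) (p : S) m :
    (forall A B : {set 'I_n}, A \in K -> B \subset A -> B \in K) ->
    stanley_reisner_ideal K p -> msupport m \in K -> p@_m = 0.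
Proof.
move=> subK [s gs ->] mK; rewrite raddf_sum big_seq big1 //= => c /gs[A AK cA].
apply: memN_msupp_eq0; apply: contraNN AK; rewrite cA prod_varsE.
move=> /msuppM_le/allpairsP[[m1 m2] /= [_]].
rewrite msuppX inE => /eqP-> mE; apply: subK mK _; apply/subsetP => i iA.
rewrite inE mE mnmDE mnm_sumE (bigD1 i) //= mnm1E eqxx.
by rewrite add1n addnS.
Qed.

Lemma msupport1 i : msupport U_(i)%MM = [set i].
Proof. by apply/setP => j; rewrite !inE mnm1E [j == i]eq_sym; case: (i == j). Qed.

Lemma msupport2 i j : msupport (U_(i) + U_(j))%MM = [set i; j].
Proof.
apply/setP => k; rewrite !inE mnmDE !mnm1E ![k == _]eq_sym.
by case: (i == k); case: (j == k).
Qed.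

Lemma mcoeff_mulX (p : S) (x u v : 'I_n) :
  ('X_x * p)@_(U_(u) + U_(v)) =
  if x == u then p@_U_(v) else if x == v then p@_U_(u) else 0.
Proof.
rewrite mulrC; have [->|xu] := eqVneq x u; first by rewrite mcoeffMX.
have [->|xv] := eqVneq x v; first by rewrite addmC mcoeffMX.
apply: memN_msupp_eq0; apply/negP => /msuppM_le/allpairsP[[m1 m2] /= [_]].
rewrite msuppX inE => /eqP-> /(congr1 (fun m : 'X_{1..n} => m x)).
by rewrite !mnmDE !mnm1E ![_ == x]eq_sym (negPf xu) (negPf xv) eqxx addn1.
Qed.

(** For [u = v] the two contributions coincide and count once; this yields the diagonal equations of
    a motion. *)
Lemma mcoeff_lform_mul (Q : 'M[F]_n) i (p : S) (u v : 'I_n) :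
  (lform Q i * p)@_(U_(u) + U_(v)) =
  Q i u * p@_U_(v) + (if u == v then 0 else Q i v * p@_U_(u)).
Proof.
rewrite big_distrl raddf_sum /=.
under eq_bigr do rewrite -scalerAl mcoeffZ mcoeff_mulX.
rewrite (bigD1 u) //= eqxx; congr (_ + _); have [->|uv] := eqVneq u v.
  by rewrite big1 // => x /negPf->; rewrite mulr0.
rewrite (bigD1 v) 1?eq_sym //= (negPf uv) eqxx big1 ?addr0 //.
by move=> x /andP[/negPf-> /negPf->]; rewrite mulr0.
Qed.

Lemma linear_eq0 (p : S) : shifted_homog 0 1 p -> (forall v, p@_U_(v) = 0) -> p = 0.
Proof.
move=> /shifted_homogE hp p0; apply/mpolyP => m; rewrite mcoeff0.
have [/mdeg1P[v /eqP->] //|ne] := boolP (mdeg m == 1%N).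
by apply: hp; rewrite addn0.
Qed.

Lemma complete_basis D (A : 'M[F]_(D, n)) (Dn : (D <= n)%N) : row_free A ->
  exists2 Q : 'M[F]_n, Q \in unitmx &
    forall t j, Q (widen_ord Dn t) j = A t j.
Proof.
have En := subnKC Dn; move: (n - D)%N En => e En; move: A Dn.
rewrite -En => A Dn rA.
exists (block_mx (col_ebase A) 0 0 (1%:M : 'M_e) *m row_ebase A).
  rewrite unitmx_mul row_ebase_unit andbT unitmxE det_lblock det1 mulr1 -unitmxE.
  exact: col_ebase_unit.
move=> t j; have -> : widen_ord Dn t = lshift e t by apply: val_inj.
set B := block_mx _ _ _ _; have -> : (B *m row_ebase A) (lshift e t) j =
    (usubmx (B *m row_ebase A)) t j by rewrite [RHS]mxE.
rewrite -mul_usub_mx col_mxKu -[in RHS](mulmx_ebase A) (eqP rA) pid_mx_row.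
by rewrite mul_mx_row mulmx1 mulmx0.
Qed.
End StanleyReisner.

(** * The linear strand of the relative face module *)

Section Strand.
Variables (F : fieldType) (n d : nat) (Delta : {set {set 'I_n}}).
Hypothesis Delta_npm : normal_pseudomanifold_with_boundary d Delta.
Hypothesis Delta_vertices : full_vertex_set Delta.
Local Notation S := {mpoly F[n]}.
Local Notation I := (@stanley_reisner_ideal F n (boundary d Delta)).
Local Notation J := (@stanley_reisner_ideal F n Delta).
Variable P : graded_free_resolution I J.

Definition interior_vertices := [set v : 'I_n | [set v] \notin boundary d Delta].

Lemma boundary_sub (A B : {set 'I_n}) :
  A \in boundary d Delta -> B \subset A -> B \in boundary d Delta.
Proof.
rewrite inE => /exists_inP[R RB AR] BA; rewrite inE; apply/exists_inP; exists R => //.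
exact: subset_trans AR.
Qed.

Lemma set0_boundary : set0 \in boundary d Delta.
Proof.
have [R RB] := set0Pn _ (proj2 Delta_npm); rewrite inE; apply/exists_inP.
by exists R => //; apply: sub0set.
Qed.

(** The empty face lies in the boundary, so the relative complex has [f_(-1) = 0] and only [f_0]
    remains. *)
Lemma g1_interior : (0 < d)%N ->
  g1_number d (relative_faces d Delta) = #|interior_vertices|%:Z.
Proof.
move=> d0; have f0 : face_count (relative_faces d Delta) 0 = 0%N.
  apply/eqP; rewrite cards_eq0; apply/eqP/setP => A.
  rewrite in_set in_setD cards_eq0 in_set0; apply/negP => /andP[/andP[AB _] /eqP A0].
  by rewrite A0 set0_boundary in AB.
have f1 : face_count (relative_faces d Delta) 1 = #|interior_vertices|.
  rewrite -(card_imset (mem interior_vertices) (@set1_inj _)); apply: eq_card => A.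
  apply/idP/imsetP => [|[v vI ->]].
    rewrite in_set in_setD => /andP[/andP[vB _] /cards1P[v Av]].
    by exists v; rewrite // in_set -Av.
  by rewrite in_set in vI; rewrite in_set in_setD cards1 vI Delta_vertices.
rewrite /g1_number /h_number !big_ord_recl !big_ord0 /= f0 f1.
by rewrite (_ : Posz 0 = 0) // !mulr0 !addr0 add0r /bump subnn expr0 bin0 !mul1r.
Qed.

(** A linear form in the ideal of the boundary involves no boundary vertex, so its coefficients at
    the interior vertices determine it. *)
Lemma strand_le_degree0 (Q : 'M[F]_n) : Q \in unitmx ->
  strand_le Q P 0 0 #|interior_vertices|.
Proof.
move=> Qu m u hu _.
exists (\matrix_(x, y) (\sum_l u x l * res_aug l)@_U_(enum_val y)) => p c cA.
have hcu : graded_rows 1 (map_mx (@mpolyC n F) c *m u) by apply: graded_rows_const.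
have [x|w hw Ew] := graded_lift hcu; last first.
  by exists w => //; rewrite Ew subrr map_mx0.
apply/res_exact0; rewrite (_ : \sum_k _ = 0); first exact: ideal_generated0.
apply: linear_eq0 => [|v].
  apply: shifted_homog_sum => l _; rewrite mxE.
  apply: shifted_homogM (hcu x l) _ => m' /(dhomog_mf (res_aug_homog l)) <-.
  exact: addn0.
have [vB|vI] := boolP ([set v] \in boundary d Delta).
  apply: (stanley_reisner_coeff (K := boundary d Delta)).
  - exact: boundary_sub.
  - by apply: ideal_generated_comb => l; apply: res_aug_mem.
  - by rewrite msupport1.
have vI' : v \in interior_vertices by rewrite inE.
move/matrixP/(_ x (enum_rank_in vI' v)): cA; rewrite [RHS]mxE => <-.
rewrite mxE.
transitivity (\sum_y c x y * (\sum_l u y l * res_aug l)@_U_(v)); last first.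
  by apply: eq_bigr => y _; rewrite mxE enum_rankK_in.
under eq_bigr do rewrite 2!mxE big_distrl.
rewrite exchange_big raddf_sum /=; apply: eq_bigr => y _.
rewrite -mcoeffZ scaler_sumr; congr (mcoeff _ _); apply: eq_bigr => l _.
by rewrite mxE mul_mpolyC scalerAl.
Qed.

Lemma boundary_regular (Q : 'M[F]_n) (a : 'I_n -> 'rV[F]_d.+1) (dn : (d.+1 <= n)%N) :
    (forall t j, Q (widen_ord dn t) j = a j 0 t) ->
    (forall c : 'I_n -> 'rV[F]_d.+1,
      (forall v, [set v] \in boundary d Delta -> c v = 0) ->
      (forall v, dot (a v) (c v) = 0) ->
      (forall x y, [set x; y] \in Delta -> dot (a x) (c y) + dot (a y) (c x) = 0) ->
      forall v, c v = 0) ->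
  forall k, (k <= d.+1)%N ->
  forall p : 'I_n -> S, (forall s, I (p s)) -> (forall s, shifted_homog 0 1 (p s)) ->
    J (\sum_(s : 'I_n | (s < k)%N) lform Q s * p s) ->
  forall s : 'I_n, (s < k)%N -> J (p s).
Proof.
move=> Qa rig k kd p Ip hp Jp s sk; rewrite (_ : p s = 0); first exact: ideal_generated0.
have subD : forall A B : {set 'I_n}, A \in Delta -> B \subset A -> B \in Delta.
  by have [_] := npm_complex (proj1 Delta_npm).
apply: linear_eq0 (hp s) _ => v.
(* The velocity of [v] collects the coefficients of [x_v] in the [p s]; padding by zero from [k] on
   treats all [k <= d + 1] alike. *)
pose c (v : 'I_n) : 'rV[F]_d.+1 :=
  \row_(t < d.+1) if (t < k)%N then (p (widen_ord dn t))@_U_(v) else 0.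
have E x y : [set x; y] \in Delta ->
    dot (a x) (c y) + (if x == y then 0 else dot (a y) (c x)) = 0.
  rewrite -msupport2 => /(stanley_reisner_coeff subD Jp) E0; rewrite -[RHS]E0.
  transitivity (\sum_(t < d.+1 | (t < k)%N)
      (lform Q (widen_ord dn t) * p (widen_ord dn t))@_(U_(x) + U_(y))).
    under [RHS]eq_bigr do rewrite mcoeff_lform_mul !Qa.
    rewrite big_split /=; congr (_ + _).
      rewrite [RHS]big_mkcond; apply: eq_bigr => t _; rewrite mxE.
      by case: ifP => _ //; rewrite mulr0.
    case: eqP => _; first by rewrite big1.
    rewrite [RHS]big_mkcond; apply: eq_bigr => t _; rewrite mxE.
    by case: ifP => _ //; rewrite mulr0.
  rewrite raddf_sum /= -(big_ord_narrow_cond dn (P := fun t => (t < k)%N)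
    (F := fun t => (lform Q t * p t)@_(U_(x) + U_(y)))).
  apply: eq_bigl => t; case: (ltnP t k) => // tk.
  by rewrite (leq_trans tk).
have c0 : forall w, c w = 0.
  apply: rig => [w wB|w|x y xy].
  - apply/rowP => t; rewrite !mxE; case: ifP => // _.
    apply: (stanley_reisner_coeff (K := boundary d Delta)) (Ip _) _.
      exact: boundary_sub.
    by rewrite msupport1.
  - have := E w w; rewrite setUid eqxx addr0; apply; exact: Delta_vertices.
  - have := E x y xy; case: eqP => // -> e; move: e; rewrite addr0 => ->.
    by rewrite addr0.
have sd : (s < d.+1)%N by apply: leq_trans sk kd.
have := c0 v => /rowP/(_ (Ordinal sd)); rewrite !mxE /= sk => <-.
by congr (mcoeff _ (p _)); apply: val_inj.
Qed.

Lemma strand_interior : infinite_type F -> (3 <= d)%N ->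
  forall i, exists2 Q : 'M[F]_n, Q \in unitmx &
    strand_le Q P n i (#|interior_vertices| * 'C(n - d - 1, i)).
Proof.
move=> Finf d3 i.
(* Without interior vertices [n] may equal [d], as for a single simplex, leaving no room for [d + 1]
   independent forms; but then every strand vanishes. *)
have [V0|[v0 v0I]] := set_0Vmem interior_vertices.
  have Qu : (1%:M : 'M[F]_n) \in unitmx by apply: unitmx1.
  exists 1%:M => //; rewrite V0 cards0 mul0n.
  have H0 k : strand_le 1%:M P k 0 0.
    by apply: (strand_le_quotient Qu); have := strand_le_degree0 Qu; rewrite V0 cards0.
  have H : forall k i', (k <= n)%N -> strand_le 1%:M P k i' 0.
    elim=> [|k IH] [|i'] kn //; first exact: strand_le_exact.
    exact: (strand_le_succ Qu (k := Ordinal kn) (IH i'.+1 (ltnW kn)) (IH i' (ltnW kn))).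
  exact: H.
have [a rig] := pinned_boundary_rigidity d3 Delta_npm Finf Delta_vertices.
pose A : 'M[F]_(d.+1, n) := \matrix_(t, j) a j 0 t.
(* A relation [l] among the forms gives a motion with velocity [l] at the interior vertex [v0] and
   zero elsewhere. *)
have freeA : row_free A.
  apply: inj_row_free => l lA.
  have dl v : dot (a v) l = 0.
    move/rowP/(_ v): lA; rewrite !mxE => <-; apply: eq_bigr => t _.
    by rewrite mxE mulrC.
  have := rig (fun v => if v == v0 then l else 0) _ _ _ v0; rewrite eqxx; apply.
  - by move=> v vB; case: eqP => // vv0; rewrite inE -vv0 vB in v0I.
  - by move=> v; case: ifP => _; rewrite ?dot0r.
  - by move=> x y _; case: ifP => _; case: ifP => _; rewrite ?dot0r ?dl ?addr0.
have dn : (d.+1 <= n)%N by rewrite -(eqP freeA) rank_leq_col.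
have [Q Qu QA] := complete_basis dn freeA; exists Q => //.
have Qa t j : Q (widen_ord dn t) j = a j 0 t by rewrite QA mxE.
have H1 k : (k <= d.+1)%N -> strand_le Q P k 1 0.
  move=> kd; apply: (strand_le_regular Qu) => [|p|g].
  - exact: leq_trans kd dn.
  - exact: (boundary_regular Qa rig kd).
  - by apply: ideal_generated_comb => l; apply: res_aug_mem.
have H0 k : strand_le Q P k 0 #|interior_vertices|.
  exact/strand_le_quotient/strand_le_degree0.
have HV i' : strand_le Q P d.+1 i'.+1 0 by apply: (strand_le_vanish Qu dn H1).
have := strand_le_pascal Qu HV H0 (m := n - d.+1) (i := i).
by rewrite subnKC // -subnDA addn1; apply.
Qed.
End Strand.

Theorem theorem5p9 (F : fieldType) (n d : nat) (Delta : {set {set 'I_n}})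
    (F_infinite : infinite_type F)
    (d_ge3 : (3 <= d)%N)
    (Delta_npm : normal_pseudomanifold_with_boundary d Delta)
    (Delta_vertices : full_vertex_set Delta)
    (P : graded_free_resolution
           (@stanley_reisner_ideal F n (boundary d Delta))
           (@stanley_reisner_ideal F n Delta))
    (i : nat) :
  (betti P i i.+1)%:Z
    <= g1_number d (relative_faces d Delta) * ('C(n - d - 1, i))%:Z.
Proof.
have d0 : (0 < d)%N by apply: leq_trans d_ge3.
have [Q _ HQ] := strand_interior Delta_npm Delta_vertices P F_infinite d_ge3 i.
rewrite g1_interior // -PoszM lez_nat.
exact: betti_le HQ.
Qed.
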